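(* Let $T,d\in\mathbb{N}$, let $K\subseteq\mathbb{R}^d$ be a compact subset and let $f\in\mathcal{C}(K^{T-1})$ be a continuous real-valued function. Let the activation function $\sigma:\mathbb{R}\to\mathbb{R}$ be continuous, bounded, non-polynomial, injective and satisfy $\sigma(0)=0$. Let the randomised signature $\mathrm{RS}$ have random weights drawn according to Sampling Scheme 1 (described in the context), with dimension $N=M+Td$. Then for any $\alpha\in(0,1)$ and $\varepsilon>0$ there exists $M\in\mathbb{N}$ such that, with probability greater than $\alpha$, there exists $\tilde w\in\mathbb{R}^M$ such that $$\sup_{x_1,\dots,x_{T-1}\in K}\bigl|f(x_1,\dots,x_{T-1})-\langle w,\Delta \mathrm{RS}_T(x_1,\dots,x_{T-1})\rangle\bigr|<\varepsilon$$ for the output vector $w:=[\,\tilde w^{\top}\;\;0_{1\times Td}\,]^{\top}\in\mathbb{R}^{M+Td}$, where $\langle\cdot,\cdot\rangle$ denotes the standard scalar product on $\mathbb{R}^{M+Td}$.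
   Context: **Randomised signature.** Let $x:\{1,\dots,T\}\to\mathbb{R}^d$ be a datastream, $x_t=(x_t^1,\dots,x_t^d)$. Given $N\in\mathbb{N}$, random matrices $A_1,A_2^1,\dots,A_2^d\in\mathbb{R}^{N\times N}$ and random vectors $\xi_1,\xi_2^1,\dots,\xi_2^d\in\mathbb{R}^N$ on a probability space $(\Omega,\mathcal{F},\mathbb{P})$, and $\sigma:\mathbb{R}\to\mathbb{R}$ (applied componentwise to vectors), the randomised signature of $x$ is defined by $\mathrm{RS}_0(x)=0\in\mathbb{R}^N$ and $$\mathrm{RS}_t(x)=\mathrm{RS}_{t-1}(x)+\sigma(A_1\mathrm{RS}_{t-1}(x)+\xi_1)+\sum_{i=1}^d\sigma(A_2^i\mathrm{RS}_{t-1}(x)+\xi_2^i)\,x_t^i,\quad t=1,\dots,T.$$ Write $\Delta\mathrm{RS}_t(x):=\mathrm{RS}_t(x)-\mathrm{RS}_{t-1}(x)$. **Sampling Scheme 1.** Let $N=M+Td$ with $M\in\mathbb{N}$. For $i=1,\dots,d$, $$A_1=\begin{bmatrix} 0_{M\times M} & A_1^{(1)} \\ 0_{Td\times M} & A_1^{(2)} \end{bmatrix},\quad \xi_1=\begin{bmatrix} \xi_1^{(1)} \\ 0_{Td\times1} \end{bmatrix},\quad A_2^i=0_{N\times N},\quad \xi_2^i=\begin{bmatrix} 0_{M\times1} \\ \alpha_i e_i \end{bmatrix},$$ where $e_i$ is the $i$-th canonical basis vector of $\mathbb{R}^{Td}$, $A_1^{(1)}\in\mathbb{R}^{M\times Td}$,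 $\xi_1^{(1)}\in\mathbb{R}^M$, $\alpha_1,\dots,\alpha_d$ are real random variables, and $$A_1^{(2)}=\begin{bmatrix} 0_{d\times(T-1)d} & 0_{d\times d} \\ U & 0_{(T-1)d\times d} \end{bmatrix}\in\mathbb{R}^{Td\times Td}$$ with $U\in\mathbb{R}^{(T-1)d\times(T-1)d}$ an upper triangular random matrix (entries on and above the diagonal random, entries below the diagonal zero). All random entries of $A_1^{(1)}$, $U$, $\xi_1^{(1)}$ and the variables $\alpha_1,\dots,\alpha_d$ are i.i.d. with common law $\mu_1$, an absolutely continuous probability distribution on $\mathbb{R}$ with full support. **Notation $\Delta\mathrm{RS}_T(x_1,\dots,x_{T-1})$.** Under this scheme the first $M$ components of $\Delta\mathrm{RS}_T(x)$ do not depend on $x_T$; since the last $Td$ entries of $w$ are zero, $\langle w,\Delta\mathrm{RS}_T(x)\rangle$ is a function of $(x_1,\dots,x_{T-1})$ only, and $\langle w,\Delta\mathrm{RS}_T(x_1,\dots,x_{T-1})\rangle$ denotes this value (for any choice of $x_T\in\mathbb{R}^d$). *)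

(* Defs.v *)
From HB Require Import structures.
From mathcomp Require Import all_boot all_order all_algebra.
From mathcomp Require Import all_classical all_reals all_analysis.

Set Implicit Arguments.
Unset Strict Implicit.
Unset Printing Implicit Defensive.

Import Order.TTheory GRing.Theory Num.Theory.
Import numFieldNormedType.Exports.

Local Open Scope classical_set_scope.
Local Open Scope ring_scope.

Definition polynomial_fun (R : realType) (g : R -> R) : Prop :=
  exists p : {poly R}, forall x, g x = p.[x].

Definition inner (R : realType) (N : nat) (u v : 'cV[R]_N) : R :=
  \sum_(i < N) u i 0 * v i 0.

Definition full_support (R : realType)
    (mu : probability (measurableTypeR R) R) : Prop :=
  forall O : set R, open O -> O !=set0 -> (0 < mu O)%E.

Section Iid.
Context (R : realType) (disp : measure_display) (Omega : measurableType disp).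
Context (P : probability Omega R) (I : finType) (Z : I -> {RV P >-> R}).

Definition mutually_independent : Prop :=
  forall (J : {set I}) (B : I -> set R), (forall i, measurable (B i)) ->
    P (\bigcap_(i in [set` J]) (Z i @^-1` B i)) =
    (\prod_(i in J) P (Z i @^-1` B i))%E.

Definition iid_with_law (mu : probability (measurableTypeR R) R) : Prop :=
  (forall i (B : set R), measurable B -> distribution P (Z i) B = mu B) /\
  mutually_independent.

End Iid.

Section RandomisedSignature.
Context (R : realType) (sigma : R -> R) (T d N : nat).
Context (A1 : 'M[R]_N) (A2 : 'I_d -> 'M[R]_N).
Context (xi1 : 'cV[R]_N) (xi2 : 'I_d -> 'cV[R]_N).

(* The value x_t of the datastream, t = 1, ..., T, is [x j] with [j = t - 1].
   For t > T, where the signature is not defined, x_t is read as 0. *)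
Fixpoint RS (x : 'I_T -> 'cV[R]_d) (t : nat) : 'cV[R]_N :=
  if t is s.+1 then
    let r := RS x s in
    let xt := if insub s is Some j then x j else 0 in
    r + map_mx sigma (A1 *m r + xi1)
      + \sum_(i < d) xt i 0 *: map_mx sigma (A2 i *m r + xi2 i)
  else 0.

Definition DeltaRS (x : 'I_T -> 'cV[R]_d) (t : nat) : 'cV[R]_N :=
  RS x t - RS x t.-1.

End RandomisedSignature.

(* Throughout, [n] is T - 1, so that T = n.+1 and T >= 1. *)
Section SamplingScheme.
Context (R : realType) (n d M : nat).

(* Index set of the random entries: those of A_1^(1), those of U on and above
   the diagonal, those of xi_1^(1), and alpha_1, ..., alpha_d. *)
Definition scheme1_index : finType :=
  ((('I_M * 'I_(n.+1 * d)) +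
    {ij : 'I_(n * d) * 'I_(n * d) | (ij.1 <= ij.2)%N}) +
   ('I_M + 'I_d))%type.

(* A realisation [z] of the random entries. *)
Context (z : scheme1_index -> R).

Definition scheme1_A11 : 'M[R]_(M, n.+1 * d) :=
  \matrix_(i, j) z (inl (inl (i, j))).

Definition scheme1_U : 'M[R]_(n * d) :=
  \matrix_(i, j) (if insub (i, j) is Some k then z (inl (inr k)) else 0).

Definition scheme1_xi11 : 'cV[R]_M := \col_i z (inr (inl i)).

Definition scheme1_alpha (i : 'I_d) : R := z (inr (inr i)).

(* Rows are split as d + (T-1)d and columns as (T-1)d + d; the former is
   convertible to T d, the latter is not. *)
Definition scheme1_A12 : 'M[R]_(n.+1 * d) :=
  castmx (erefl, addnC (n * d) d)
    (block_mx (0 : 'M[R]_(d, n * d)) (0 : 'M[R]_d)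
       scheme1_U (0 : 'M[R]_(n * d, d))).

Definition scheme1_A1 : 'M[R]_(M + n.+1 * d) :=
  block_mx 0 scheme1_A11 0 scheme1_A12.

Definition scheme1_xi1 : 'cV[R]_(M + n.+1 * d) := col_mx scheme1_xi11 0.

Definition scheme1_A2 (i : 'I_d) : 'M[R]_(M + n.+1 * d) := 0.

(* [lshift] views i as an index of the first d of the T d coordinates. *)
Definition scheme1_xi2 (i : 'I_d) : 'cV[R]_(M + n.+1 * d) :=
  col_mx 0 (scheme1_alpha i *:
            (delta_mx (lshift (n * d) i) 0 : 'cV[R]_(n.+1 * d))).

Definition scheme1_DeltaRS (sigma : R -> R) (x : 'I_n.+1 -> 'cV[R]_d)
    (t : nat) : 'cV[R]_(M + n.+1 * d) :=
  DeltaRS sigma scheme1_A1 scheme1_A2 scheme1_xi1 scheme1_xi2 x t.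

End SamplingScheme.

(* The stream (x_1, ..., x_{T-1}, xT). *)
Definition extend_stream (V : Type) (n : nat) (x : 'I_n -> V) (xT : V)
    (t : 'I_n.+1) : V :=
  if unlift ord_max t is Some s then x s else xT.

Definition Kpow (V : topologicalType) (K : set V) (n : nat) :
    set {ptws 'I_n -> V} :=
  [set x | forall s, K (x s)].
Arguments Kpow {V} K n _.

(* Main.v *)
Require Import Defs.
From HB Require Import structures.
From mathcomp Require Import all_boot all_order all_algebra.
From mathcomp Require Import all_classical all_reals all_analysis.
From mathcomp Require Import measurable_realfun.
From mathcomp Require Import ring lra zify.

(* Let b be the last T d coordinates of RS_{T-1}. Since U is upper triangular,
   entry c of block k + 1 moves at time t by sigma of a combination of the
   entries c, c + 1, ... of b_{t-1}, so for nonzero diagonal of U and nonzero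
   alpha_i the whole path b_1, ..., b_{T-1}, hence the stream, can be read off
   from b_{T-1}. The first M entries of the increment Delta RS_T form a one-layer
   network with random weights evaluated at b_{T-1}. A bounded continuous
   injective sigma is a sigmoid up to an affine change, so ridge functions
   exp(a . b) are limits of such networks, and they span an algebra that
   separates streams; Stone-Weierstrass gives an approximating network for every
   fixed value of (U, alpha). Good approximation is an open condition on all
   weights and (U, alpha) lies with high probability in a compact set of nonzero
   entries, so finitely many target neurons suffice; with M i.i.d. neurons of
   full support, all of them are nearly sampled with probability tending
   to 1. *)

Set Implicit Arguments.
Unset Strict Implicit.
Unset Printing Implicit Defensive.

Import Order.TTheory GRing.Theory Num.Theory.
Import numFieldNormedType.Exports.

Local Open Scope classical_set_scope.
Local Open Scope ring_scope.

(** * Stone-Weierstrass theorem *)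

(** Takes the place of finite subcovers: used for boundedness, for both halves of Stone-Weierstrass
    and for the choice of finitely many target neurons. *)
Lemma compact_ind (X : topologicalType) (C : set X) (Q : set X -> Prop) :
  compact C -> Q set0 ->
  (forall U V, U `<=` V -> Q V -> Q U) ->
  (forall U V, Q U -> Q V -> Q (U `|` V)) ->
  (forall x, C x -> exists2 U, nbhs x U & Q U) ->
  Q C.
Proof.
move=> cC Q0 Qsub QU Qloc; apply: contrapT => nQC.
(* The complements of the sets satisfying Q form a filter; a cluster point of
   it in C contradicts the local hypothesis. *)
pose F : set_system X := [set A | Q (C `\` A)].
have PF : ProperFilter F.
  split; first by move=> F0; apply: nQC; apply: Qsub F0 => x Cx; split.
  split.
  - by rewrite /F/= setDT.
  - by move=> A B FA FB; rewrite /F/= setDIr; exact: QU.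
  - by move=> A B AB; apply: Qsub => x [Cx nBx]; split => // /AB.
have FC : F C by rewrite /F/= setDv.
have [p [Cp clp]] := cC F PF FC.
have [U pU QUU] := Qloc p Cp.
have FU : F (~` U) by apply: Qsub QUU => x [_ /contrapT].
by have [x [nUx Ux]] := clp _ _ FU pU.
Qed.

Section StoneWeierstrass.
Variable R : realType.

(** The classical polynomial iteration for |t| on [-1, 1]. It uses only sums and products, so it can
    be run inside an algebra of functions. *)
Fixpoint abs_approx (k : nat) (t : R) : R :=
  if k is k'.+1 then
    abs_approx k' t + (t * t - abs_approx k' t * abs_approx k' t) / 2
  else 0.

(** With p the k-th iterate and e = |t| - p, one step multiplies e by 1 - (|t| + p)/2, which is at
    most 1 - e/2 since e <= |t| + p. This recursion forces e <= 2/(k+1), uniformly in t. *)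
Lemma abs_approxP k (t : R) : `|t| <= 1 ->
  [/\ 0 <= abs_approx k t, abs_approx k t <= `|t| &
      (`|t| - abs_approx k t) * k.+1%:R <= 2].
Proof.
move=> t1.
(* The iteration sees t only through t^2, so t >= 0 may be assumed. *)
have -> : forall k, abs_approx k t = abs_approx k `|t|.
  by elim=> //= j ->; rewrite -!expr2 real_normK ?num_real.
have : 0 <= `|t| by [].
move: `|t| t1 => {}t t1 t0; elim: k => [|k [p0 pt pk]] /=.
  by split => //; rewrite subr0 mulr1; lra.
set p := abs_approx k t in p0 pt pk *.
have tE : t - (p + (t * t - p * p) / 2) = (t - p) * (1 - (t + p) / 2) by field.
split; first by nra.
  by rewrite -subr_ge0 tE mulr_ge0//; lra.
rewrite tE; set e := t - p in pk *.
have e0 : 0 <= e by rewrite /e; lra.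
have e1 : e <= 1 by rewrite /e; lra.
apply: (@le_trans _ _ (e * (1 - e / 2) * k.+2%:R)).
  by rewrite ler_wpM2r// ler_wpM2l// /e; lra.
rewrite -(natr1 k.+1); move: pk; set m := k.+1%:R.
have m1 : 1 <= m by rewrite ler1n.
clearbody m e => pk.
nra.
Qed.

Variables (X : topologicalType) (C : set X) (A : set (X -> R)).
Hypothesis cC : compact C.
Hypothesis A_cont : forall g, A g -> continuous g.
Hypothesis A_cst : forall c, A (fun=> c).
Hypothesis A_add : forall g h, A g -> A h -> A (fun x => g x + h x).
Hypothesis A_mul : forall g h, A g -> A h -> A (fun x => g x * h x).
Hypothesis A_sep : forall x y, C x -> C y -> x <> y ->
  exists2 g, A g & g x <> g y.

(** The continuous functions in the uniform closure of [A] on [C]; the facts below make it a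
    lattice. *)
Let L (g : X -> R) := continuous g /\ forall e, 0 < e ->
  exists2 h, A h & forall x, C x -> `|g x - h x| < e.

Lemma compact_bounded (g : X -> R) : continuous g ->
  exists2 B, 0 < B & forall x, C x -> `|g x| <= B.
Proof.
move=> cg.
apply: (compact_ind (Q := fun U => exists2 B, 0 < B & forall x, U x -> `|g x| <= B) cC).
- by exists 1.
- by move=> U V UV [B B0 HB]; exists B => // x /UV /HB.
- move=> U V [B B0 HB] [B' B'0 HB']; exists (B + B'); first lra.
  by move=> x [/HB|/HB']; lra.
- move=> x _; exists [set y | `|g y| <= `|g x| + 1]; last first.
    by exists (`|g x| + 1) => //; have := normr_ge0 (g x); lra.
  have /cvgrPdist_lt/(_ _ ltr01) := cg x; apply: filterS => y gxy /=.
  have := ler_normD (g x) (g y - g x); rewrite addrC subrK (distrC (g y)); lra.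
Qed.

Let L_A g : A g -> L g.
Proof.
move=> Ag; split; first exact: A_cont.
by move=> e e0; exists g => // x _; rewrite subrr normr0.
Qed.

Let L_add g h : L g -> L h -> L (fun x => g x + h x).
Proof.
move=> [cg Hg] [ch Hh]; split.
  by move=> x; apply: cvgD; [exact: cg|exact: ch].
move=> e e0; have e20 : 0 < e / 2 by lra.
have [g' Ag' gg'] := Hg _ e20; have [h' Ah' hh'] := Hh _ e20.
exists (fun x => g' x + h' x); first exact: A_add.
move=> x Cx; have := gg' x Cx; have := hh' x Cx.
have := ler_normD (g x - g' x) (h x - h' x).
by rewrite addrACA -opprD; lra.
Qed.

Let L_scale c g : L g -> L (fun x => c * g x).
Proof.
move=> [cg Hg]; split.
  by move=> x; apply: cvgM; [exact: cvg_cst|exact: cg].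
move=> e e0; have c0 : 0 < `|c| + 1 by have := normr_ge0 c; lra.
have [g' Ag' gg'] := Hg _ (divr_gt0 e0 c0).
exists (fun x => c * g' x); first exact: A_mul.
move=> x Cx; rewrite -mulrBr normrM.
have := gg' x Cx; rewrite ltr_pdivlMr//.
have := normr_ge0 c; have := normr_ge0 (g x - g' x); nra.
Qed.

(** Dividing g by a bound B lands in [-1, 1]; B times the k-th iterate then errs by at most
    2B/(k+1). *)
Let A_abs g : A g -> L (fun x => `|g x|).
Proof.
move=> Ag; split.
  by move=> x; apply: cvg_norm; exact: A_cont.
move=> e e0; have [B B0 gB] := compact_bounded (A_cont Ag).
have [k ke] : exists k : nat, 2 * B / e < k.+1%:R.
  exists (Num.bound (2 * B / e)).
  apply: lt_trans (_ : (Num.bound (2 * B / e))%:R < _); last by rewrite ltr_nat.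
  by rewrite archi_boundP// divr_ge0//; lra.
have Ak : forall j, A (fun x => abs_approx j (B^-1 * g x)).
  elim=> [|j IH] /=; first exact: A_cst.
  have As : A (fun x => B^-1 * g x) by apply: (A_mul (A_cst _) Ag).
  apply: (A_add IH); apply: (fun H => A_mul H (A_cst _)).
  apply: (A_add (A_mul As As)).
  have -> : (fun x => - (abs_approx j (B^-1 * g x) * abs_approx j (B^-1 * g x))) =
     (fun x => (- 1) * (abs_approx j (B^-1 * g x) * abs_approx j (B^-1 * g x))).
    by apply/funext => x; rewrite mulN1r.
  exact: A_mul (A_cst _) (A_mul IH IH).
exists (fun x => B * abs_approx k (B^-1 * g x)); first exact: (A_mul (A_cst _)).
move=> x Cx.
have t1 : `|B^-1 * g x| <= 1.
  by rewrite normrM gtr0_norm ?invr_gt0// mulrC ler_pdivrMr// mul1r gB.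
have [p0 pt] := abs_approxP k t1.
have -> : `|g x| = B * `|B^-1 * g x|.
  by rewrite normrM gtr0_norm ?invr_gt0// mulVKf// gt_eqF.
rewrite -mulrBr [`|B * _|]normrM (gtr0_norm B0) ger0_norm ?subr_ge0//.
move: ke; rewrite ltr_pdivrMr//.
set q := _ - _; set m := k.+1%:R => ke qm.
have q0 : 0 <= q by rewrite subr_ge0.
have m0 : 0 < m by rewrite ltr0n.
clearbody q m; rewrite -(ltr_pM2r m0).
by apply: le_lt_trans (_ : B * 2 < _); [rewrite -mulrA ler_wpM2l// ltW|lra].
Qed.

Let L_abs g : L g -> L (fun x => `|g x|).
Proof.
move=> [cg Hg]; split; first by move=> x; apply: cvg_norm; exact: cg.
move=> e e0; have e20 : 0 < e / 2 by lra.
have [g' Ag' gg'] := Hg _ e20.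
have [_ /(_ _ e20) [h Ah gh]] := A_abs Ag'.
exists h => // x Cx; have := gg' x Cx; have := gh x Cx.
have := ler_dist_dist (g x) (g' x).
have := ler_normD (`|g x| - `|g' x|) (`|g' x| - h x).
by rewrite addrA subrK; lra.
Qed.

Let L_max g h : L g -> L h -> L (fun x => Num.max (g x) (h x)).
Proof.
move=> Lg Lh.
have -> : (fun x => Num.max (g x) (h x)) =
    (fun x => 2^-1 * ((g x + h x) + `|g x + (-1) * h x|)).
  apply/funext => x; rewrite mulN1r.
  have [gh|gh] := leP (g x) (h x).
    by rewrite ler0_norm ?subr_le0//; field.
  by rewrite gtr0_norm ?subr_gt0//; field.
by apply/L_scale/(L_add (L_add Lg Lh))/L_abs/L_add/L_scale.
Qed.

Let L_min g h : L g -> L h -> L (fun x => Num.min (g x) (h x)).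
Proof.
move=> Lg Lh.
have -> : (fun x => Num.min (g x) (h x)) =
    (fun x => (-1) * Num.max ((-1) * g x) ((-1) * h x)).
  apply/funext => x; rewrite !mulN1r.
  by rewrite -oppr_min opprK.
by apply/L_scale/L_max; exact: L_scale.
Qed.

Lemma interpolate (f : X -> R) x y : C x -> C y ->
  exists g, [/\ A g, g x = f x & g y = f y].
Proof.
move=> Cx Cy; have [->|xy] := pselect (x = y).
  by exists (fun=> f y).
have [g Ag gxy] := A_sep Cx Cy xy.
have gd : g y - g x != 0 by rewrite subr_eq0; apply/eqP => /esym.
pose c := (f y - f x) / (g y - g x).
exists (fun z => c * g z + (f x - c * g x)); split.
- exact: A_add (A_mul (A_cst _) Ag) (A_cst _).
- by rewrite addrC subrK.
- by rewrite /c; field.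
Qed.

(** Lattice argument: for each x, a maximum of two-point interpolants over a finite cover equals f
    at x and lies above f - e/2 on [C]; a minimum of such functions over finitely many x also lies
    below f + e/2. *)
Theorem stone_weierstrass (f : X -> R) (e : R) : continuous f -> 0 < e ->
  exists2 g, A g & forall x, C x -> `|f x - g x| < e.
Proof.
move=> cf e0; have e20 : 0 < e / 2 by lra.
suff [g [Lg gf fg]] : exists g, [/\ L g, forall x, C x -> f x - e / 2 < g x &
    forall x, C x -> g x < f x + e / 2].
  have [_ /(_ _ e20)[h Ah gh]] := Lg; exists h => // x Cx.
  have := gf x Cx; have := fg x Cx; have := gh x Cx.
  by rewrite !ltr_norml => /andP[? ?] ? ?; apply/andP; split; lra.
have step x : C x -> exists g, [/\ L g, g x = f x &
    forall y, C y -> f y - e / 2 < g y].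
  move=> Cx.
  apply: (compact_ind (Q := fun U => exists g, [/\ L g, g x = f x &
    forall y, U y -> f y - e / 2 < g y]) cC).
  - by exists (fun=> f x); split => //; exact/L_A/A_cst.
  - by move=> U V UV [g [Lg gx gV]]; exists g; split => // y /UV /gV.
  - move=> U V [g [Lg gx gU]] [h [Lh hx hV]].
    exists (fun x => Num.max (g x) (h x)); split; first exact: L_max.
      by rewrite gx hx maxxx.
    by move=> y [/gU|/hV] H; rewrite lt_max H ?orbT.
  - move=> y Cy; have [g [Ag gx gy]] := interpolate f Cx Cy.
    exists [set z | f z - e / 2 < g z]; last by exists g; split => //; exact: L_A.
    have cgf : (fun z => g z - f z) @ y --> g y - f y.
      by apply: cvgB; [exact: A_cont|exact: cf].
    have /cvgrPdist_lt/(_ _ e20) := cgf; apply: filterS => z /=.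
    by rewrite gy subrr sub0r normrN ltr_norml => /andP[? ?]; lra.
apply: (compact_ind (Q := fun U => exists g, [/\ L g,
    forall x, C x -> f x - e / 2 < g x & forall x, U x -> g x < f x + e / 2]) cC).
- have [[x Cx]|C0] := pselect (exists x, C x).
    by have [g [Lg _ gf]] := step x Cx; exists g.
  exists (fun=> 0); split => //; first exact/L_A/A_cst.
  by move=> x Cx; exfalso; apply: C0; exists x.
- by move=> U V UV [g [Lg gf gV]]; exists g; split => // y /UV /gV.
- move=> U V [g [Lg gf gU]] [h [Lh hf hV]].
  exists (fun x => Num.min (g x) (h x)); split; first exact: L_min.
    by move=> x Cx; rewrite lt_min gf ?hf.
  by move=> y [/gU|/hV] H; rewrite gt_min H ?orbT.
- move=> x Cx; have [g [Lg gx gf]] := step x Cx.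
  exists [set z | g z < f z + e / 2]; last by exists g; split.
  have cgf : (fun z => g z - f z) @ x --> g x - f x.
    by apply: cvgB; [exact: Lg.1|exact: cf].
  have /cvgrPdist_lt/(_ _ e20) := cgf; apply: filterS => z /=.
  by rewrite gx subrr sub0r normrN ltr_norml => /andP[? ?]; lra.
Qed.

End StoneWeierstrass.

(** * Density of one-layer networks *)

Section SigmoidalApproximation.
Variable R : realType.

(** A triple (c, u, v) encodes the neuron c sigma(u t + v). *)
Definition affine_span (sigma g : R -> R) : Prop :=
  exists s : seq (R * R * R),
    g = fun t => \sum_(q <- s) q.1.1 * sigma (q.1.2 * t + q.2).

Lemma affine_span_add sigma g h : affine_span sigma g -> affine_span sigma h ->
  affine_span sigma (fun t => g t + h t).
Proof.
move=> [s ->] [s' ->]; exists (s ++ s').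
by apply/funext => t; rewrite big_cat.
Qed.

Lemma affine_span_scale sigma c g : affine_span sigma g ->
  affine_span sigma (fun t => c * g t).
Proof.
move=> [s ->]; exists [seq (c * q.1.1, q.1.2, q.2) | q <- s].
apply/funext => t; rewrite big_map mulr_sumr.
by apply: eq_bigr => q _; rewrite mulrA.
Qed.

Lemma affine_span_affine sigma u v g : affine_span sigma g ->
  affine_span sigma (fun t => g (u * t + v)).
Proof.
move=> [s ->]; exists [seq (q.1.1, q.1.2 * u, q.1.2 * v + q.2) | q <- s].
apply/funext => t; rewrite big_map.
by apply: eq_bigr => q _ /=; rewrite mulrDr mulrA addrA.
Qed.

Lemma affine_span_refl sigma : affine_span sigma sigma.
Proof.
exists [:: (1, 1, 0)]; apply/funext => t.
by rewrite big_seq1/= !mul1r addr0.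
Qed.

(** A neuron with inner weight 0 and bias 1 is a nonzero constant. *)
Lemma affine_span_cst sigma c : sigma 1 != 0 -> affine_span sigma (fun=> c).
Proof.
move=> s1; exists [:: (c / sigma 1, 0, 1)]; apply/funext => t.
by rewrite big_seq1/= mul0r add0r divfK.
Qed.

Lemma affine_span_sum sigma (g : nat -> R -> R) k : sigma 1 != 0 ->
  (forall j, affine_span sigma (g j)) ->
  affine_span sigma (fun t => \sum_(0 <= j < k) g j t).
Proof.
move=> s1 Hg; elim: k => [|k IH].
  under eq_fun do rewrite big_geq//.
  exact: affine_span_cst.
under eq_fun do rewrite big_nat_recr//=.
exact: affine_span_add.
Qed.

Variable sigma : R -> R.
Hypothesis sigma_continuous : continuous sigma.
Hypothesis sigma_bounded : exists B : R, forall t, `|sigma t| <= B.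
Hypothesis sigma_injective : injective sigma.
Hypothesis sigma1 : sigma 1 != 0.

(** Normalise by the infimum m and the supremum p, where m < p by strict monotonicity; points where
    [tau] is nearly extremal control both tails. *)
Lemma bounded_mono_sigmoid (tau : R -> R) : (exists B : R, forall t, `|tau t| <= B) ->
  {mono tau : x y / x <= y} ->
  exists a b : R, (forall t : R, 0 <= a * tau t + b <= 1) /\
    forall eta : R, 0 < eta -> exists2 T : R, 0 < T &
      forall t : R, (T <= t -> 1 - eta <= a * tau t + b) /\
                (t <= - T -> a * tau t + b <= eta).
Proof.
move=> [B tB] mt.
have hs : has_sup (range tau).
  split; first by exists (tau 0), 0.
  by exists B => _ [x _ <-]; rewrite (le_trans (ler_norm _))//; exact: tB.
have hi : has_inf (range tau).
  split; first by exists (tau 0), 0.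
  exists (- B) => _ [x _ <-]; rewrite lerNl (le_trans (ler_norm _))// normrN.
  exact: tB.
set p := sup (range tau); set m := inf (range tau).
have tp t : tau t <= p by apply: ub_le_sup; [exact: hs.2|exists t].
have tm t : m <= tau t by apply: ge_inf; [exact: hi.2|exists t].
have mp : 0 < p - m.
  rewrite subr_gt0; apply: le_lt_trans (tm 0) _.
  by apply: lt_le_trans (tp 1); rewrite (leW_mono mt).
exists (p - m)^-1, (- (p - m)^-1 * m).
have E t : (p - m)^-1 * tau t + - (p - m)^-1 * m = (tau t - m) / (p - m).
  by rewrite mulNr -mulrBr mulrC.
split.
  move=> t; rewrite E; apply/andP; split.
    by rewrite divr_ge0// ?subr_ge0// -subr_ge0 ltW.
  by rewrite ler_pdivrMr// mul1r lerD2r.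
move=> eta eta0; have e0 : 0 < eta * (p - m) by exact: mulr_gt0.
have [_ [x _ <-] xp] := sup_adherent e0 hs.
have [_ [y _ <-] ym] := inf_adherent e0 hi.
exists (`|x| + `|y| + 1) => [|t].
  by have := normr_ge0 x; have := normr_ge0 y; lra.
split=> tT; rewrite E.
  have : tau x <= tau t.
    by rewrite mt; have := ler_norm x; have := normr_ge0 y; lra.
  by rewrite ler_pdivlMr//; rewrite -/p in xp; lra.
have : tau t <= tau y.
  by rewrite mt; have := ler_norm (- y); rewrite normrN; have := normr_ge0 x; lra.
by rewrite ler_pdivrMr//; rewrite -/m in ym; lra.
Qed.

(** A continuous injection of the line is strictly monotone; a decreasing one is first reflected by
    t -> -t. *)
Lemma sigmoid_in_span : exists s, [/\ affine_span sigma s,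
    forall t, 0 <= s t <= 1 &
    forall eta : R, 0 < eta -> exists2 T : R, 0 < T &
      forall t : R, (T <= t -> 1 - eta <= s t) /\ (t <= - T -> s t <= eta)].
Proof.
have cs : {within [set` `]-oo, +oo[%R], continuous sigma}.
  by apply: continuous_subspaceT => x; exact: sigma_continuous.
have is' : {in `]-oo, +oo[ &, injective sigma}.
  by move=> x y _ _; exact: sigma_injective.
case: (itv_continuous_inj_mono cs is').
- move=> H; have mt : {mono sigma : x y / x <= y}.
    by apply: le_mono => x y; apply: H; rewrite in_itv.
  have [a [b [H1 H2]]] := bounded_mono_sigmoid sigma_bounded mt.
  exists (fun t => a * sigma t + b); split => //.
  apply: affine_span_add; last exact: affine_span_cst.
  exact/affine_span_scale/affine_span_refl.
- move=> H; pose tau t := sigma (-1 * t + 0).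
  have mt : {mono tau : x y / x <= y}.
    by apply: le_mono => x y xy; apply: H; rewrite ?in_itv//= !addr0 !mulN1r ltrN2.
  have tb : exists B : R, forall t, `|tau t| <= B.
    by have [B HB] := sigma_bounded; exists B => t; exact: HB.
  have [a [b [H1 H2]]] := bounded_mono_sigmoid tb mt.
  exists (fun t => a * tau t + b); split => //.
  apply: affine_span_add; last exact: affine_span_cst.
  exact/affine_span_scale/affine_span_affine/affine_span_refl.
Qed.

(** Half of the error budget pays for the rise of exp over two grid cells, the other half for the
    tails of the sigmoids. *)
Lemma expR_sigmoid_approx (B e : R) : 0 < B -> 0 < e ->
  exists2 g, affine_span sigma g & forall t, `|t| <= B -> `|expR t - g t| < e.
Proof.
move=> B0 e0; have [s [sS s01 slim]] := sigmoid_in_span.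
have EB := expR_gt0 B.
(* By continuity of exp at 0, a grid of k cells on [-B, B] is fine enough that exp rises by less
   than e/2 over any two adjacent cells. *)
have [k k0 kh] : exists2 k : nat, (0 < k)%N &
    expR B * (expR (2 * (2 * B / k%:R)) - 1) < e / 2.
  have e1 : 0 < e / 2 / expR B by rewrite divr_gt0//; lra.
  have /cvgrPdist_lt/(_ _ e1) := @continuous_expR R 0.
  move=> /nbhs_ballP[d /= d0 Hd].
  exists (Num.bound (4 * B / d)).+1 => //.
  set k := (Num.bound _).+1.
  have k0 : (0 : R) < k%:R by rewrite ltr0n.
  have kd : 4 * B / d < k%:R.
    apply: lt_trans (_ : (Num.bound (4 * B / d))%:R < _); last by rewrite ltr_nat /k.
    by rewrite archi_boundP// divr_ge0//; lra.
  have := Hd (2 * (2 * B / k%:R)).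
  rewrite /ball/= sub0r normrN expR0 distrC.
  have h0 : 0 < 2 * (2 * B / k%:R) by rewrite mulr_gt0// divr_gt0//; lra.
  rewrite gtr0_norm// (_ : 2 * (2 * B / k%:R) = 4 * B / k%:R); last by rewrite !mulrA -natrM.
  have qd : 4 * B / k%:R < d by move: kd; rewrite !ltr_pdivrMr// [k%:R * d]mulrC.
  move=> /(_ qd); rewrite ltr_pdivlMr// mulrC; apply: le_lt_trans.
  by apply: ler_wpM2l; [exact: ltW|exact: ler_norm].
set h := 2 * B / k%:R in kh.
have kR : (0 : R) < k%:R by rewrite ltr0n.
have h0 : 0 < h by rewrite divr_gt0// mulr_gt0.
pose x (j : nat) : R := - B + h * j%:R.
pose D (j : nat) : R := expR (x j.+1) - expR (x j).
have xS j : x j.+1 = x j + h by rewrite /x -natr1; lra.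
have D0 j : 0 <= D j by rewrite subr_ge0 ler_expR xS; lra.
have telD i : \sum_(0 <= j < i) D j = expR (x i) - expR (x 0%N).
  by rewrite telescope_sumr.
(* The jumps add up to at most exp B, so tails of size [eta] cost at most e/2 in total. *)
pose eta := e / 2 / expR B.
have eta0 : 0 < eta by rewrite divr_gt0//; lra.
have etaB : eta * expR B = e / 2 by rewrite divfK// gt_eqF.
have [T T0 HT] := slim _ eta0.
(* This slope makes each sigmoid settle, up to [eta], at distance one cell from its centre. *)
pose u := T / h.
have u0 : 0 < u by rewrite divr_gt0.
have uh : u * h = T by rewrite divfK// gt_eqF.
pose w j t := s (u * t + - (u * x j)).
(* A staircase of sigmoids with jump D j at x j, each step rising within one
   cell of the grid up to eta. *)
exists (fun t => expR (x 0%N) + \sum_(0 <= j < k) D j * w j t).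
  apply: affine_span_add; first exact: affine_span_cst.
  apply: affine_span_sum => // j; apply: affine_span_scale.
  exact: affine_span_affine.
move=> t; rewrite ler_norml => /andP[Bt tB].
(* The cell containing t. Steps before i are nearly complete and steps after i + 1 have barely
   begun; only steps i and i + 1 are uncontrolled. *)
have [i [ik it ti]] : exists i, [/\ (i <= k)%N, x i <= t & t < x i.+1].
  have q0 : 0 <= (t + B) / h by rewrite divr_ge0//; lra.
  have /andP[i1 i2] := truncn_itv q0.
  exists (Num.truncn ((t + B) / h)); move: (Num.truncn _) i1 i2 => i.
  rewrite ler_pdivlMr// ltr_pdivrMr// => i1 i2; split; last 2 first.
  - by rewrite /x; lra.
  - by rewrite /x; lra.
  rewrite -(ler_nat R) -(ler_pM2r h0); apply: le_trans i1 _.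
  by rewrite /h mulrC divfK ?gt_eqF//; lra.
have w01 j : 0 <= w j t <= 1 by exact: s01.
have low j : (j < i)%N -> 1 - eta <= w j t.
  move=> ji; apply: (HT _).1.
  have : x j.+1 <= x i by rewrite lerD2l (ler_pM2l h0) ler_nat.
  rewrite xS -mulrBr -uh => H; rewrite (ler_pM2l u0); lra.
have upp j : (i.+1 < j)%N -> w j t <= eta.
  move=> ij; apply: (HT _).2.
  have : x i.+2 <= x j by rewrite lerD2l (ler_pM2l h0) ler_nat.
  rewrite xS -mulrBr -uh -mulrN => H; rewrite (ler_pM2l u0); lra.
have x0 : x 0%N = - B by rewrite /x mulr0 addr0.
have xk : x k = B by rewrite /x mulrC /h mulrC divfK ?gt_eqF//; lra.
have E0 : 0 < expR (x 0%N) by exact: expR_gt0.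
have gap : expR (x i.+2) - expR (x i) < e / 2.
  apply: le_lt_trans kh.
  rewrite (_ : x i.+2 = x i + 2 * h); last by rewrite !xS; lra.
  rewrite expRD -[X in _ - X]mulr1 -mulrBr ler_wpM2r//.
    by rewrite subr_ge0 -{1}(@expR0 R) ler_expR; lra.
  by rewrite ler_expR; lra.
have tlow : expR (x i) <= expR t by rewrite ler_expR.
have tupp : expR t <= expR (x i.+2) by rewrite ler_expR [x i.+2]xS; lra.
have xiB : expR (x i) <= expR B by rewrite ler_expR; lra.
have Glow : (1 - eta) * (expR (x i) - expR (x 0%N)) <=
    \sum_(0 <= j < k) D j * w j t.
  rewrite (@big_cat_nat _ _ _ i)//= -[X in X <= _]addr0 lerD//.
    rewrite -telD mulr_sumr !big_nat; apply: ler_sum => j /andP[_ ji].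
    by rewrite mulrC ler_wpM2l// low.
  by apply: sumr_ge0 => j _; rewrite mulr_ge0//; case/andP: (w01 j).
have Gupp : \sum_(0 <= j < k) D j * w j t <=
    eta * (expR B - expR (x 0%N)) + (expR (x i.+2) - expR (x 0%N)).
  rewrite -xk -!telD.
  apply: le_trans (_ : \sum_(0 <= j < k) (eta * D j +
      (if (j < i.+2)%N then D j else 0)) <= _).
    apply: ler_sum => j _; case: ifPn => ji.
      have /andP[_ w1] := w01 j; apply: le_trans (_ : D j <= _).
        by rewrite ler_piMr.
      by rewrite lerDr mulr_ge0// ltW.
    by rewrite addr0 mulrC ler_wpM2r// upp// ltnNge -ltnS.
  rewrite big_split/= -mulr_sumr lerD2l -big_mkcond/= !big_mkord.
  rewrite -(big_mkord (fun j => (j < i.+2)%N) D) -(big_mkord xpredT D).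
  (* Since i + 2 may exceed k, both sums are widened to a common range. *)
  rewrite (@big_nat_widen _ _ _ 0 i.+2 (maxn k i.+2)) ?leq_maxr//.
  rewrite (@big_nat_widen _ _ _ 0 k (maxn k i.+2)) ?leq_maxl//=.
  rewrite [leLHS]big_mkcond [leRHS]big_mkcond/=; apply: ler_sum => j _.
  by case: ifP => [/andP[->]//|_]; case: ifP.
rewrite ltr_norml; apply/andP.
clear - Glow Gupp gap tlow tupp etaB eta0 E0 EB xiB e0.
set S := \sum_(0 <= j < k) _ in Glow Gupp *; clearbody S eta.
by split; nra.
Qed.

End SigmoidalApproximation.

Lemma continuous_sumr (R : realType) (X : topologicalType) (I : Type)
    (r : seq I) (F : I -> X -> R) : (forall i, continuous (F i)) ->
  continuous (fun x => \sum_(i <- r) F i x).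
Proof.
move=> cF; apply: continuous_big => [|i _]; last exact: cF.
exact: add_continuous.
Qed.

(** * One-layer networks composed with an injective feature map *)

Section UniversalApproximation.
Variables (R : realType) (sigma : R -> R).
Hypothesis sigma_continuous : continuous sigma.
Hypothesis sigma_bounded : exists B : R, forall t, `|sigma t| <= B.
Hypothesis sigma_injective : injective sigma.
Hypothesis sigma1 : sigma 1 != 0.

Variables (X : topologicalType) (C : set X) (m : nat) (Phi : X -> 'cV[R]_m).
Hypothesis cC : compact C.
Hypothesis Phi_continuous : forall j, continuous (fun x => Phi x j 0).
Hypothesis Phi_injective : forall x y, C x -> C y -> Phi x = Phi y -> x = y.

Let lin (a : 'rV[R]_m) (x : X) : R := (a *m Phi x) 0 0.

Lemma continuous_lin a : continuous (lin a).
Proof.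
have -> : lin a = fun x => \sum_j a 0 j * Phi x j 0.
  by apply/funext => x; rewrite /lin mxE.
apply: continuous_sumr => j x; apply: cvgM; first exact: cvg_cst.
exact: Phi_continuous.
Qed.

Let exp_sum : set (X -> R) := [set g | exists s : seq (R * 'rV[R]_m),
  g = fun x => \sum_(q <- s) q.1 * expR (lin q.2 x)].

(** Products of exponentials of linear forms are again such exponentials, so their sums form an
    algebra; injectivity of [Phi] on [C] lets a coordinate separate points. *)
Lemma exp_sum_dense (f : X -> R) (e : R) : continuous f -> 0 < e ->
  exists s : seq (R * 'rV[R]_m), forall x, C x ->
    `|f x - \sum_(q <- s) q.1 * expR (lin q.2 x)| < e.
Proof.
move=> cf e0.
suff [_ [s ->] H] : exists2 g, exp_sum g & forall x, C x -> `|f x - g x| < e.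
  by exists s.
apply: stone_weierstrass cf e0 => //.
- move=> _ [s ->]; apply: continuous_sumr => q x.
  apply: cvgM; first exact: cvg_cst.
  apply: (@continuous_comp _ _ _ (lin q.2) expR); first exact: continuous_lin.
  exact: continuous_expR.
- move=> c; exists [:: (c, 0)]; apply/funext => x.
  by rewrite big_seq1/= /lin mul0mx mxE expR0 mulr1.
- move=> _ _ [s ->] [s' ->]; exists (s ++ s').
  by apply/funext => x; rewrite big_cat.
- move=> _ _ [s ->] [s' ->].
  exists [seq (q.1 * q'.1, q.2 + q'.2) | q <- s, q' <- s'].
  apply/funext => x; rewrite big_allpairs_dep/= mulr_suml.
  apply: eq_bigr => q _; rewrite mulr_sumr; apply: eq_bigr => q' _.
  have -> : lin (q.2 + q'.2) x = lin q.2 x + lin q'.2 x.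
    by rewrite /lin mulmxDl [LHS]mxE.
  by rewrite expRD mulrACA.
- move=> x y Cx Cy xy.
  have [j xyj] : exists j, Phi x j 0 != Phi y j 0.
    apply: contrapT => H; apply: xy; apply: Phi_injective => //.
    apply/matrixP => j k; rewrite ord1; apply/eqP/negPn/negP => xyj.
    by apply: H; exists j.
  exists (fun z => expR (lin (delta_mx 0 j) z)).
    exists [:: (1, delta_mx 0 j)]; apply/funext => z.
    by rewrite big_seq1 mul1r.
  by rewrite /lin -!rowE !mxE => /expR_inj /eqP; apply/negP.
Qed.

Theorem ridge_network_dense (f : X -> R) (e : R) : continuous f -> 0 < e ->
  exists s : seq (R * 'rV[R]_m * R), forall x, C x ->
    `|f x - \sum_(q <- s) q.1.1 * sigma ((q.1.2 *m Phi x) 0 0 + q.2)| < e.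
Proof.
move=> cf e0; have e20 : 0 < e / 2 by lra.
have [s Hs] := exp_sum_dense cf e20.
suff [s' Hs'] : exists s' : seq (R * 'rV[R]_m * R), forall x, C x ->
    `|\sum_(q <- s) q.1 * expR (lin q.2 x) -
      \sum_(q <- s') q.1.1 * sigma ((q.1.2 *m Phi x) 0 0 + q.2)| < e / 2.
  exists s' => x Cx; have := Hs x Cx; have := Hs' x Cx.
  by rewrite !ltr_norml => /andP[? ?] /andP[? ?]; apply/andP; split; lra.
(* Exponentials are replaced one at a time, each on the bounded range of its linear form, spending
   half of the remaining budget. *)
elim: s (e / 2) e20 {Hs} => [|[c a] s IH] d d0.
  by exists [::] => x _; rewrite !big_nil subrr normr0.
have d20 : 0 < d / 2 by lra.
have [s' Hs'] := IH _ d20.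
have [B B0 HB] := compact_bounded cC (@continuous_lin a).
have c0 : 0 < `|c| + 1 by have := normr_ge0 c; lra.
have [_ [r ->] Hr] := expR_sigmoid_approx sigma_continuous sigma_bounded
  sigma_injective sigma1 B0 (divr_gt0 d20 c0).
exists ([seq (c * q.1.1, q.1.2 *: a, q.2) | q <- r] ++ s') => x Cx.
rewrite big_cons big_cat big_map/=.
have E (q : R * R * R) : c * q.1.1 * sigma ((q.1.2 *: a *m Phi x) 0 0 + q.2) =
    c * (q.1.1 * sigma (q.1.2 * lin a x + q.2)).
  have -> : (q.1.2 *: a *m Phi x) 0 0 = q.1.2 * lin a x.
    by rewrite -scalemxAl [LHS]mxE.
  by rewrite mulrA.
rewrite (eq_bigr _ (fun q _ => E q)) -mulr_sumr opprD addrACA -mulrBr.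
apply: le_lt_trans (ler_normD _ _) _; rewrite normrM.
have := Hs' x Cx; have := Hr _ (HB x Cx); rewrite ltr_pdivlMr// /lin.
set u : R := `|expR _ - _| => ud vd.
have : 0 <= u by exact: normr_ge0.
have := normr_ge0 c; clearbody u; nra.
Qed.

End UniversalApproximation.

(** * Dynamics of the randomised signature *)

Section State.
Variables (R : realType) (sigma : R -> R) (n d : nat).

(** The block A_1^(2) for an arbitrary U, convertible to [scheme1_A12] when U is sampled. *)
Definition shift_mx (U : 'M[R]_(n * d)) : 'M[R]_(n.+1 * d) :=
  castmx (erefl, addnC (n * d) d)
    (block_mx (0 : 'M[R]_(d, n * d)) (0 : 'M[R]_d) U (0 : 'M[R]_(n * d, d))).

(* The last T d coordinates of RS_t, as a function of U and the alpha_i. *)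
Fixpoint state (U : 'M[R]_(n * d)) (al : 'I_d -> R) (x : 'I_n -> 'cV[R]_d)
    (t : nat) : 'cV[R]_(n.+1 * d) :=
  if t is s.+1 then
    let b := state U al x s in
    let xt := if insub s is Some j then x j else 0 in
    b + map_mx sigma (shift_mx U *m b)
      + \sum_(i < d) xt i 0 *:
          map_mx sigma (al i *: (delta_mx (lshift (n * d) i) 0 : 'cV_(n.+1 * d)))
  else 0.

Lemma shift_mxE U (k l : 'I_(n.+1 * d)) :
  shift_mx U k l =
  if fintype.split (k : 'I_(d + n * d)) is inr i then
    if fintype.split (cast_ord (esym (addnC (n * d) d)) l) is inl j then U i j else 0
  else 0.
Proof.
rewrite /shift_mx castmxE cast_ord_id /block_mx mxE.
by case: splitP => i _; rewrite mxE; case: splitP => j _; rewrite ?mxE.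
Qed.

Lemma stateS U al x t (k : 'I_(n.+1 * d)) :
  state U al x t.+1 k 0 = state U al x t k 0
    + sigma (\sum_l shift_mx U k l * state U al x t l 0)
    + \sum_(i < d) (if insub t is Some j then x j else 0) i 0 *
        sigma (al i * (k == lshift (n * d) i)%:R).
Proof.
rewrite /= !mxE summxE; congr (_ + _).
by apply: eq_bigr => i _; rewrite !mxE eqxx andbT.
Qed.

(** Columns are cut after (T-1)d entries and rows after d: [low j] keeps the value of j, while
    [rshift d c] adds d. This offset is what shifts the state down by one block. *)
Let low (j : 'I_(n * d)) : 'I_(n.+1 * d) :=
  cast_ord (addnC (n * d) d) (lshift d j).

Lemma shift_mx_top U (b : 'cV[R]_(n.+1 * d)) (i : 'I_d) :
  \sum_l shift_mx U (lshift (n * d) i) l * b l 0 = 0.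
Proof.
apply: big1 => l _; rewrite shift_mxE.
case: splitP => [j _|j /= ij]; first by rewrite mul0r.
by have := ltn_ord i; rewrite ij ltnNge leq_addr.
Qed.

Lemma shift_mx_bottom U (b : 'cV[R]_(n.+1 * d)) (c : 'I_(n * d)) :
  \sum_l shift_mx U (rshift d c) l * b l 0 = \sum_j U c j * b (low j) 0.
Proof.
rewrite (reindex (cast_ord (addnC (n * d) d)))/=; last first.
  by apply: onW_bij; exists (cast_ord (esym (addnC (n * d) d)));
    [exact: cast_ordK|exact: cast_ordKV].
rewrite big_split_ord/= [X in _ + X]big1 ?addr0.
  apply: eq_bigr => j _; rewrite shift_mxE cast_ordK.
  case: splitP => [i /= ic|i /= /addnI ic].
    by have := ltn_ord i; rewrite -ic ltnNge leq_addr.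
  have -> : i = c by exact/val_inj.
  case: splitP => [i' /= ji|i' /= ji]; last first.
    by have := ltn_ord j; rewrite ji ltnNge leq_addr.
  by congr (U c _ * _); exact/val_inj.
move=> j _; rewrite shift_mxE cast_ordK.
case: splitP => [i _|i _]; first by rewrite mul0r.
case: splitP => [i' /= ji|i' _]; last by rewrite mul0r.
by have := ltn_ord i'; rewrite -ji ltnNge leq_addr.
Qed.

Hypothesis sigma0 : sigma 0 = 0.

Lemma state_top U al x t (i : 'I_d) :
  state U al x t.+1 (lshift (n * d) i) 0 = state U al x t (lshift (n * d) i) 0
    + (if insub t is Some j then x j else 0) i 0 * sigma (al i).
Proof.
rewrite stateS shift_mx_top sigma0 addr0; congr (_ + _).
rewrite (bigD1 i)//= eqxx mulr1 big1 ?addr0// => j ji.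
by rewrite (inj_eq (@lshift_inj _ _)) eq_sym (negbTE ji) mulr0 sigma0 mulr0.
Qed.

Lemma state_bottom U al x t (c : 'I_(n * d)) :
  state U al x t.+1 (rshift d c) 0 = state U al x t (rshift d c) 0
    + sigma (\sum_j U c j * state U al x t (low j) 0).
Proof.
rewrite stateS shift_mx_bottom [X in _ + X]big1 ?addr0// => i _.
by rewrite eq_rlshift mulr0 sigma0 mulr0.
Qed.

(** Entry d + c is fed only by entries c, c + 1, ... because U is upper triangular, so the state
    fills at most one more block per time step. *)
Lemma state_support (U : 'M[R]_(n * d)) al x t (k : 'I_(n.+1 * d)) :
  (forall i j : 'I_(n * d), (j < i)%N -> U i j = 0) ->
  (t * d <= k)%N -> state U al x t k 0 = 0.
Proof.
move=> Utri; elim: t k => [|t IH] k tk; first by rewrite mxE.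
case: (split_ordP (k : 'I_(d + n * d))) tk => c -> /=.
  by rewrite leqNgt (leq_trans (ltn_ord c))// mulSn leq_addr.
rewrite mulSn leq_add2l => tc.
rewrite state_bottom IH ?(leq_trans tc) ?leq_addl// add0r big1 ?sigma0// => j _.
have [jc|cj] := ltnP j c; first by rewrite Utri// mul0r.
by rewrite IH ?mulr0//= (leq_trans tc).
Qed.

(** The dynamics can be run backwards from the final state; the increments of the top block are then
    x_t^i sigma(alpha_i), with nonzero factor sigma(alpha_i). *)
Lemma state_injective (U : 'M[R]_(n * d)) (al : 'I_d -> R) (x y : 'I_n -> 'cV[R]_d) :
  (0 < d)%N -> injective sigma ->
  (forall i j : 'I_(n * d), (j < i)%N -> U i j = 0) ->
  (forall i, U i i != 0) -> (forall i, al i != 0) ->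
  state U al x n = state U al y n -> x = y.
Proof.
move=> d0 sinj Utri Udiag al0 Hn.
have H s : (s <= n)%N -> state U al x (n - s) = state U al y (n - s).
  elim: s => [|s IH] sn; first by rewrite subn0.
  (* Going back from time t + 1 to t, entry c + d of b_{t+1} determines entry c
     of b_t once the later entries of b_t are known. *)
  have := IH (ltnW sn); rewrite -subSS subSn// subnS/=.
  set t := (n - s.+1)%N; have tn : (t < n)%N by rewrite /t; lia.
  have -> : (n - s)%N = t.+1 by rewrite /t; lia.
  move=> /matrixP Ht.
  (* Descending induction on the entry: [k] bounds the distance from c to the end. *)
  suff E k : forall c : 'I_(n.+1 * d), (n.+1 * d - c <= k)%N ->
      state U al x t c 0 = state U al y t c 0.
    by apply/matrixP => c j; rewrite ord1; exact: (E (n.+1 * d)%N _ (leq_subr _ _)).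
  elim: k => [|k IHk] c ck; first by have := ltn_ord c; lia.
  have [tc|ct] := leqP (t * d) c; first by rewrite !state_support.
  have cn : (c < n * d)%N.
    by apply: leq_trans ct _; rewrite leq_mul2r ltnW ?orbT.
  have IH' (c' : 'I_(n.+1 * d)) : (c < c')%N ->
      state U al x t c' 0 = state U al y t c' 0.
    by move=> cc'; apply: IHk; have := ltn_ord c'; lia.
  pose c' := Ordinal cn.
  (* As d > 0, entry c + d of b_t comes after c and cancels. Injectivity of [sigma] and the nonzero
     diagonal entry of U then isolate entry c. *)
  have := Ht (rshift d c') 0; rewrite !state_bottom (IH' (rshift d c'))/=; last by lia.
  move/addrI/sinj; rewrite (bigD1 c')//= [RHS](bigD1 c')//=.
  rewrite [X in _ + X](_ : _ = \sum_(i < n * d | i != c') U c' i * state U al y t (low i) 0).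
    move/addIr/(mulfI (Udiag c')).
    by rewrite (_ : low c' = c)//; exact/val_inj.
  apply: eq_bigr => j jc; have [jc'|] := ltnP j c'; first by rewrite Utri// !mul0r.
  rewrite leq_eqVlt => /orP[/eqP cj|cj]; last by rewrite IH'.
  by move: jc; rewrite -val_eqE/= -cj eqxx.
apply/funext => t; apply/matrixP => i j; rewrite ord1.
have Et s : (s <= n)%N -> state U al x s = state U al y s.
  by move=> sn; have := H (n - s)%N (leq_subr _ _); rewrite subKn.
have /matrixP/(_ (lshift (n * d) i) 0) := Et t.+1 (ltn_ord t).
rewrite !state_top (Et t (ltnW (ltn_ord t))) => /addrI.
rewrite valK => /mulIf; apply.
by apply: contra_neq (al0 i); rewrite -{1}sigma0 => /sinj.
Qed.

(** The parameter space [Y] serves both for streams alone, with fixed weights, and for pairs of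
    weights and stream. *)
Lemma continuous_state (Y : topologicalType) (U : Y -> 'M[R]_(n * d))
    (al : Y -> 'I_d -> R) (x : Y -> 'I_n -> 'cV[R]_d) :
  continuous sigma ->
  (forall i j, continuous (fun y => U y i j)) ->
  (forall i, continuous (fun y => al y i)) ->
  (forall s i, continuous (fun y => x y s i 0)) ->
  forall t k, continuous (fun y => state (U y) (al y) (x y) t k 0).
Proof.
move=> cs cU cal cx; elim=> [|t IH] k.
  rewrite (_ : (fun _ => _) = fun=> 0); first by move=> y; exact: cvg_cst.
  by apply/funext => y; rewrite mxE.
under eq_fun do rewrite stateS.
move=> y; apply: cvgD; first apply: cvgD; first exact: IH.
  apply: (@continuous_comp _ _ _
    (fun y => \sum_l shift_mx (U y) k l * state (U y) (al y) (x y) t l 0) sigma).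
    apply: continuous_sumr => l {}y; apply: cvgM; last exact: IH.
    rewrite shift_mxE; under eq_fun do rewrite shift_mxE.
    by case: fintype.split => i; [|case: fintype.split => j]; try exact: cvg_cst; exact: cU.
  exact: cs.
apply: continuous_sumr => i {}y; apply: cvgM.
  case: insub => [s|]; first exact: cx.
  by under eq_fun do rewrite mxE; rewrite mxE; exact: cvg_cst.
apply: (@continuous_comp _ _ _ (fun y => al y i * (k == lshift (n * d) i)%:R) sigma).
  by apply: cvgM; [exact: cal|exact: cvg_cst].
exact: cs.
Qed.

End State.

(** * Reduction of the sampled signature to a one-layer network *)

Section Scheme.
Variables (R : realType) (sigma : R -> R) (n d M : nat).
Hypothesis sigma0 : sigma 0 = 0.
Variable z : scheme1_index n d M -> R.

Let RSz (x : 'I_n.+1 -> 'cV[R]_d) := RS sigma (scheme1_A1 z)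
  (@scheme1_A2 R n d M) (scheme1_xi1 z) (scheme1_xi2 z) x.

(** The left blocks of A_1 and all A_2^i vanish, so the last T d coordinates evolve on their own; up
    to time T - 1 the value [xT] has not been read. *)
Lemma dsubmx_RS (x : 'I_n -> 'cV[R]_d) xT t : (t <= n)%N ->
  dsubmx (RSz (extend_stream x xT) t) =
  state sigma (scheme1_U z) (scheme1_alpha z) x t.
Proof.
elim: t => [|t IH] tn; first by apply/matrixP => i j; rewrite !mxE.
have {}IH := IH (ltnW tn).
have -> : RSz (extend_stream x xT) t.+1 =
  RSz (extend_stream x xT) t +
  map_mx sigma (scheme1_A1 z *m RSz (extend_stream x xT) t + scheme1_xi1 z) +
  \sum_(i < d) x (Ordinal tn) i 0 *:
     map_mx sigma (0 *m RSz (extend_stream x xT) t + scheme1_xi2 z i).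
  rewrite /RSz /= insubT ?(leq_trans tn)// => tn1; congr (_ + _).
  apply: eq_bigr => i _; congr ((_ : 'cV_d) i 0 *: _).
  rewrite /extend_stream (_ : Sub t tn1 = lift ord_max (Ordinal tn)) ?liftK//.
  by apply: val_inj; rewrite /= /bump leqNgt tn.
rewrite !linearD/= linear_sum/= IH; congr (_ + _ + _).
  rewrite -map_dsubmx linearD/= /scheme1_xi1 col_mxKd addr0.
  by rewrite /scheme1_A1 -[X in _ *m X]vsubmxK mul_block_col col_mxKd mul0mx add0r IH.
rewrite insubT; apply: eq_bigr => i _; rewrite linearZ/=; congr (_ *: _).
by rewrite -map_dsubmx mul0mx add0r /scheme1_xi2 col_mxKd.
Qed.

(** The first M entries of each xi_2^i are 0 and sigma(0) = 0, so [xT] leaves the first M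
    coordinates of the increment untouched. *)
Lemma inner_DeltaRS (x : 'I_n -> 'cV[R]_d) xT (w : 'cV[R]_M) :
  inner (col_mx w 0 : 'cV[R]_(M + n.+1 * d))
    (scheme1_DeltaRS z sigma (extend_stream x xT) n.+1) =
  \sum_(i < M) w i 0 *
    sigma ((row i (scheme1_A11 z) *m
            state sigma (scheme1_U z) (scheme1_alpha z) x n) 0 0
           + scheme1_xi11 z i 0).
Proof.
rewrite /inner big_split_ord/= [X in _ + X]big1 ?addr0; last first.
  by move=> i _; rewrite col_mxEd mxE mul0r.
apply: eq_bigr => i _; rewrite col_mxEu; congr (_ * _).
have -> : scheme1_DeltaRS z sigma (extend_stream x xT) n.+1 =
  map_mx sigma (scheme1_A1 z *m RSz (extend_stream x xT) n + scheme1_xi1 z) +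
  \sum_(j < d) (if insub n is Some s then extend_stream x xT s else 0) j 0 *:
     map_mx sigma (0 *m RSz (extend_stream x xT) n + scheme1_xi2 z j).
  by rewrite /scheme1_DeltaRS /DeltaRS/= -[X in X - _]addrA [LHS]addrAC subrr add0r.
rewrite [LHS]mxE summxE [X in _ + X]big1 ?addr0 => [|j _]; last first.
  by rewrite mul0mx add0r 2!mxE col_mxEu mxE sigma0 mulr0.
rewrite [LHS]mxE; congr sigma.
rewrite [LHS]mxE [X in _ + X]col_mxEu; congr (_ + _).
rewrite -[X in _ *m X]vsubmxK dsubmx_RS// /scheme1_A1 mul_block_col.
by rewrite col_mxEu mul0mx add0r -row_mul [RHS]mxE.
Qed.

End Scheme.

(** * Stability under perturbation of the weights *)

Section Robustness.
Variables (R : realType) (n d : nat).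
Hypothesis d_gt0 : (0 < d)%N.
Variable K : set 'cV[R]_d.
Hypothesis K_compact : compact K.
Variable f : {ptws 'I_n -> 'cV[R]_d} -> R.
Hypothesis f_continuous : {within Kpow K n, continuous f}.
Variable sigma : R -> R.
Hypothesis sigma_continuous : continuous sigma.
Hypothesis sigma_bounded : exists B : R, forall t, `|sigma t| <= B.
Hypothesis sigma_injective : injective sigma.
Hypothesis sigma0 : sigma 0 = 0.
Variable eps : R.
Hypothesis eps_gt0 : 0 < eps.

Definition dyn_index : finType :=
  ({ij : 'I_(n * d) * 'I_(n * d) | (ij.1 <= ij.2)%N} + 'I_d)%type.

(* One row of A_1^(1), with the bias of that neuron at [None]. *)
Definition neuron_index : finType := option 'I_(n.+1 * d).

Definition dyn_to_scheme M (k : dyn_index) : scheme1_index n d M :=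
  match k with inl ij => inl (inr ij) | inr i => inr (inr i) end.

Definition neuron_to_scheme M (i : 'I_M) (k : neuron_index) :
    scheme1_index n d M :=
  if k is Some j then inl (inl (i, j)) else inr (inl i).

Definition scheme_of M (th : dyn_index -> R) (rho : 'I_M -> neuron_index -> R)
    (k : scheme1_index n d M) : R :=
  match k with
  | inl (inl (i, j)) => rho i (Some j)
  | inl (inr ij) => th (inl ij)
  | inr (inl i) => rho i None
  | inr (inr i) => th (inr i)
  end.

Let final_state M (z : scheme1_index n d M -> R) (x : 'I_n -> 'cV[R]_d) :=
  state sigma (scheme1_U z) (scheme1_alpha z) x n.

Definition readout M (z : scheme1_index n d M -> R) (w : 'cV[R]_M)
    (x : 'I_n -> 'cV[R]_d) : R :=
  \sum_(i < M) w i 0 *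
    sigma ((row i (scheme1_A11 z) *m final_state z x) 0 0 + scheme1_xi11 z i 0).

(** A supremum strictly below [eps] is expressed by a uniform bound e < [eps], which leaves room for
    perturbation. *)
Definition approximates M (z : scheme1_index n d M -> R) : Prop :=
  exists (w : 'cV[R]_M) (e : R), e < eps /\
    forall x, Kpow K n x -> `|f x - readout z w x| <= e.

Lemma approximates_sup M (z : scheme1_index n d M -> R) :
  approximates z <->
  exists w' : 'cV[R]_M,
    let w := col_mx w' 0 : 'cV[R]_(M + n.+1 * d) in
    forall xT : 'cV[R]_d,
      (ereal_sup [set (`| f x - inner w (scheme1_DeltaRS z sigma
                             (extend_stream x xT) n.+1) |)%:E | x in Kpow K n]
       < eps%:E)%E.
Proof.
split=> [[w [e [ee He]]]|[w Hw]]; exists w => /=.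
  move=> xT; apply: (@le_lt_trans _ _ e%:E); last by rewrite lte_fin.
  by apply: ge_ereal_sup => _ [x Kx <-]; rewrite lee_fin inner_DeltaRS//; exact: He.
have := Hw 0; set S : set (\bar R) := [set _ | _ in _].
have SE x : Kpow K n x -> S (`|f x - readout z w x|)%:E.
  by move=> Kx; exists x => //; rewrite inner_DeltaRS.
have : ubound S (ereal_sup S) by exact: ereal_sup_ubound.
case: (ereal_sup S) => [r| |] ub Hr //; last first.
  (* The supremum is -oo: there is no stream in [Kpow K n], and any bound below [eps] serves. *)
  by exists (eps - 1); split; [lra|move=> x /SE/ub].
by exists r; split => // x /SE/ub; rewrite lee_fin.
Qed.

(** Tychonoff, stated in the subspace topology because [f] is continuous only there. *)
Lemma Kpow_compact : compact (Kpow K n : set (subspace (Kpow K n))).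
Proof.
suff : compact (Kpow K n).
  by move=> H; rewrite -[X in compact X]setIid; apply/compact_subspaceIP; rewrite setIid.
by apply: (@tychonoff _ (fun=> 'cV[R]_d) (fun=> K)).
Qed.

Let stream_coord_continuous (s : 'I_n) (i : 'I_d) :
  continuous (fun x : subspace (Kpow K n) => x s i 0).
Proof.
apply: continuous_subspaceT => x.
apply: (@continuous_comp _ _ _ (fun x : {ptws 'I_n -> 'cV[R]_d} => x s)
   (fun v : 'cV[R]_d => v i 0)).
  exact: (@proj_continuous _ (fun=> 'cV[R]_d) s).
exact: coord_continuous.
Qed.

(** Tube argument with the output weights kept fixed: the error is jointly continuous in weights and
    stream, and compactness of the set of streams makes the neighbourhood of the weights uniform. *)
Lemma approximates_open M (z : scheme1_index n d M -> R) : approximates z ->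
  exists2 delta : R, 0 < delta &
    forall z', (forall k, `|z k - z' k| < delta) -> approximates z'.
Proof.
move=> [w [e [ee He]]].
pose N := #|scheme1_index n d M|.
pose X := subspace (Kpow K n).
(* Weights are listed in a row vector, whose balls are exactly entrywise bounds. *)
pose read (y : 'rV[R]_N) k : R := y 0 (enum_rank k).
have cread k : continuous (fun p : 'rV[R]_N * X => read p.1 k).
  move=> p; apply: (@continuous_comp _ _ _ fst (fun y : 'rV[R]_N => read y k)).
    exact: cvg_fst.
  exact: coord_continuous.
have cU i j : continuous (fun p : 'rV[R]_N * X => scheme1_U (read p.1) i j).
  rewrite (_ : (fun _ => _) = fun p : 'rV[R]_N * X =>
      if insub (i, j) is Some k then read p.1 (inl (inr k)) else 0).
    by case: insub => [k|]; [exact: cread|move=> p; exact: cvg_cst].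
  by apply/funext => p; rewrite mxE.
have cx s i : continuous (fun p : 'rV[R]_N * X => p.2 s i 0).
  move=> p; apply: (@continuous_comp _ _ _ snd (fun x : X => x s i 0)).
    exact: cvg_snd.
  exact: stream_coord_continuous.
have cS k : continuous (fun p : 'rV[R]_N * X => final_state (read p.1) p.2 k 0).
  apply: (continuous_state (Y := ('rV[R]_N * X)%type)
    (U := fun p => scheme1_U (read p.1)) (al := fun p => scheme1_alpha (read p.1))
    (x := fun p => p.2)) => // i; exact: cread.
have cF : continuous (fun p : 'rV[R]_N * X => f p.2 - readout (read p.1) w p.2).
  move=> p; apply: cvgB.
    apply: (@continuous_comp _ _ _ snd (f : X -> R)); first exact: cvg_snd.
    exact: f_continuous.
  apply: continuous_sumr => i {}p; apply: cvgM; first exact: cvg_cst.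
  apply: (@continuous_comp _ _ _ (fun p : 'rV[R]_N * X =>
    (row i (scheme1_A11 (read p.1)) *m final_state (read p.1) p.2) 0 0
    + scheme1_xi11 (read p.1) i 0) sigma); last exact: sigma_continuous.
  rewrite (_ : (fun _ => _) = fun p : 'rV[R]_N * X =>
      \sum_j read p.1 (inl (inl (i, j))) * final_state (read p.1) p.2 j 0
      + read p.1 (inr (inl i))).
    apply: cvgD; last exact: cread.
    by apply: continuous_sumr => j {}p; apply: cvgM; [exact: cread|exact: cS].
  apply/funext => q; rewrite mxE; congr (_ + _); last by rewrite mxE.
  by apply: eq_bigr => j _; rewrite !mxE.
pose e' := (e + eps) / 2.
have ee' : e < e' by rewrite /e'; lra.
have e'e : e' < eps by rewrite /e'; lra.
pose y0 : 'rV[R]_N := \row_k z (enum_val k).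
have zE : read y0 = z.
  by apply/funext => k; rewrite /read mxE enum_rankK.
have /compact_near_coveringP/(_ 'rV[R]_N (nbhs y0)
  (fun y x => `|f x - readout (read y) w x| < e')) := Kpow_compact.
move=> /(_ _ _)/nbhs_ballP[].
  move=> x Kx; have := cF (y0, x).
  have d0 : 0 < e' - e by lra.
  move=> /cvgrPdist_lt/(_ _ d0) [[A B] /= [nA nB] AB].
  exists (B, A) => // -[x' y'] /= [Bx' Ay'].
  have := AB (y', x') (conj Ay' Bx'); have := He x Kx; rewrite /= zE.
  set u := f x - _; set v := f x' - _ => ue uv.
  have := ler_normD u (v - u); rewrite addrC subrK (distrC v); lra.
move=> /= delta delta0 Hd; exists delta => // z' zz'.
exists w, e'; split => // x Kx; apply/ltW.
pose y1 : 'rV[R]_N := \row_k z' (enum_val k).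
have -> : z' = read y1 by apply/funext => k; rewrite /read mxE enum_rankK.
by apply: Hd Kx; split => // i j; rewrite /ball/= !mxE.
Qed.

Lemma scheme_ofK M (z : scheme1_index n d M -> R) :
  z = scheme_of (z \o dyn_to_scheme M) (fun i => z \o neuron_to_scheme i).
Proof. by apply/funext => -[[[i j]|ij]|[i|i]]. Qed.

Lemma readout_scheme_of M (th : dyn_index -> R) rho w x :
  readout (scheme_of th rho : scheme1_index n d M -> R) w x =
  \sum_(i < M) w i 0 * sigma (\sum_j rho i (Some j) *
      state sigma (\matrix_(i, j) if insub (i, j) is Some k then th (inl k) else 0)
         (fun i => th (inr i)) x n j 0 + rho i None).
Proof.
apply: eq_bigr => i _; congr (_ * sigma (_ + _)); last by rewrite mxE.
by rewrite mxE; apply: eq_bigr => j _; rewrite !mxE.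
Qed.

(* Targets hit by the same neuron have their output weights added. *)
Lemma approximates_reindex m M (kap : 'I_m -> 'I_M) th rho :
  approximates (scheme_of th (rho \o kap)) -> approximates (scheme_of th rho).
Proof.
move=> [w [e [ee He]]]; exists (\col_i \sum_(j | kap j == i) w j 0), e.
split => // x Kx; suff -> : readout (scheme_of th rho)
    (\col_i \sum_(j | kap j == i) w j 0) x =
  readout (scheme_of th (rho \o kap)) w x by exact: He.
rewrite !readout_scheme_of (partition_big kap xpredT)//=.
apply: eq_bigr => i _; rewrite mxE mulr_suml.
by apply: eq_bigr => j /eqP <-.
Qed.

(** For nonzero U diagonal and alpha the final state is an injective feature map, so network density
    applies; each term of the network found becomes one neuron. *)
Lemma approximates_exists (th : dyn_index -> R) : (forall k, th k != 0) ->
  exists m (rho : 'I_m -> neuron_index -> R), approximates (scheme_of th rho).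
Proof.
have [e20 e2e] : 0 < eps / 2 /\ eps / 2 < eps.
  by have e0 := eps_gt0; split; lra.
move=> th0.
pose U : 'M[R]_(n * d) :=
  \matrix_(i, j) if insub (i, j) is Some k then th (inl k) else 0.
pose Phi (x : subspace (Kpow K n)) := state sigma U (fun i => th (inr i)) x n.
have cPhi j : continuous (fun x => Phi x j 0).
  apply: (continuous_state (Y := subspace (Kpow K n)) (U := fun=> U)
    (al := fun _ i => th (inr i)) (x := fun x => x)) => //.
  - by move=> i k x; exact: cvg_cst.
  - by move=> i x; exact: cvg_cst.
have iPhi (x y : subspace (Kpow K n)) :
    Kpow K n x -> Kpow K n y -> Phi x = Phi y -> x = y.
  move=> _ _; apply: state_injective => //.
  - by move=> i j ji; rewrite mxE insubF//= leqNgt ji.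
  - by move=> i; rewrite mxE insubT.
have s1 : sigma 1 != 0.
  by apply/eqP; rewrite -sigma0 => /sigma_injective/eqP; rewrite oner_eq0.
have [s Hs] := ridge_network_dense sigma_continuous sigma_bounded
  sigma_injective s1 Kpow_compact cPhi iPhi f_continuous e20.
pose q (i : 'I_(size s)) := tnth (in_tuple s) i.
exists (size s), (fun i k => if k is Some j then (q i).1.2 0 j else (q i).2).
exists (\col_i (q i).1.1), (eps / 2); split => //.
move=> x Kx; apply/ltW; rewrite readout_scheme_of.
have := Hs x Kx; rewrite [X in _ - X](big_tnth _ _ s)/=.
congr (`|_ - _| < _); apply: eq_bigr => i _; rewrite mxE; congr (_ * sigma (_ + _)).
by rewrite mxE.
Qed.

(** Each target is a vector of neuron weights with a tolerance. Every [th] with entries in [D] has a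
    network that survives small changes of all weights, and compactness leaves finitely many
    networks. The list does not depend on M. *)
Lemma finite_targets (D : set R) : compact D -> ~ D 0 ->
  exists2 tg : seq ({ffun neuron_index -> R} * R),
    (forall t, t \in tg -> 0 < t.2) &
    forall M (z : scheme1_index n d M -> R),
      (forall k, D (z (dyn_to_scheme M k))) ->
      (forall t, t \in tg ->
        exists i : 'I_M, forall k, `|t.1 k - z (neuron_to_scheme i k)| < t.2) ->
      approximates z.
Proof.
move=> cD nD0.
pose T := {ptws dyn_index -> R}.
have cQ : compact [set th : T | forall k, D (th k)].
  by apply: (@tychonoff _ (fun=> R) (fun=> D)).
apply: (compact_ind (Q := fun V : set T =>
  exists2 tg : seq ({ffun neuron_index -> R} * R),
    (forall t, t \in tg -> 0 < t.2) &
    forall M (z : scheme1_index n d M -> R),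
      V (z \o dyn_to_scheme M) ->
      (forall t, t \in tg ->
        exists i : 'I_M, forall k, `|t.1 k - z (neuron_to_scheme i k)| < t.2) ->
      approximates z) cQ).
- by exists [::].
- by move=> V W VW [tg tg0 H]; exists tg => // M z /VW; exact: H.
- move=> V W [tg tg0 H] [tg' tg'0 H']; exists (tg ++ tg').
    by move=> t; rewrite mem_cat => /orP[/tg0|/tg'0].
  move=> M z [Vz|Wz] hit.
    by apply: H Vz _ => t ttg; apply: hit; rewrite mem_cat ttg.
  by apply: H' Wz _ => t ttg; apply: hit; rewrite mem_cat ttg orbT.
move=> th Dth; have th0 k : th k != 0.
  by apply: contra_notN nD0 => /eqP <-; exact: Dth.
have [m [rho /approximates_open[delta delta0 Hd]]] := approximates_exists th0.
exists [set th' : T | forall k, `|th k - th' k| < delta].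
  apply: (@filter_forall _ _ (fun k (th' : T) => `|th k - th' k| < delta) (nbhs (th : T))) => k.
  have ck : {for (th : T), continuous (fun th' : T => th' k : R)}.
    exact: (@proj_continuous _ (fun _ : dyn_index => R : topologicalType) k th).
  by move/cvgrPdist_lt : ck => /(_ delta delta0).
exists [seq ([ffun k => rho j k], delta) | j : 'I_m].
  by move=> t /mapP[j _ ->].
move=> M z thz hit.
have /choice[kap Hkap] (j : 'I_m) : exists i : 'I_M,
    forall k, `|rho j k - z (neuron_to_scheme i k)| < delta.
  have [|i Hi] := hit ([ffun k => rho j k], delta).
    by apply/mapP; exists j => //; rewrite mem_enum.
  by exists i => k; have := Hi k; rewrite ffunE.
rewrite [z]scheme_ofK; apply: (approximates_reindex (kap := kap)); apply: Hd.
by case=> [[[j k]|ij]|[j|i]] /=; [exact: (Hkap j (Some k))|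
  exact: (thz (inl ij))|exact: (Hkap j None)|exact: (thz (inr i))].
Qed.

End Robustness.

(** * Probability estimates *)

Section Probability.
Variables (R : realType) (disp : measure_display) (Omega : measurableType disp).
Variable P : probability Omega R.

(** Complements are introduced one event at a time, subtracting the part where that event occurs;
    the induction covers all mixed intersections [X A C]. *)
Lemma prob_bigcap_setC (I : finType) (E : I -> set Omega) (p : R) :
  (forall i, measurable (E i)) ->
  (forall A : {set I}, P (\bigcap_(i in [set` A]) E i) = (p ^+ #|A|)%:E) ->
  P (\bigcap_i ~` E i) = ((1 - p) ^+ #|I|)%:E.
Proof.
move=> mE HE.
pose X (A C : {set I}) := \bigcap_(i in [set` A]) E i
  `&` \bigcap_(i in [set` C]) ~` E i.
have mX A C : measurable (X A C).
  by apply: measurableI; apply: fin_bigcap_measurable => // i _; exact: measurableC.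
suff H k : forall A C : {set I}, #|C| = k -> (forall i, i \in A -> i \notin C) ->
    P (X A C) = (p ^+ #|A| * (1 - p) ^+ k)%:E.
  have := H #|I| finset.set0 [set: I]%SET; rewrite cardsT cards0 expr0 mul1r => <- //.
    congr (P _); apply/seteqP; split=> w /= Hw.
      by split=> [i|i _] /=; [rewrite inE|exact: Hw].
    by move=> i _; apply: Hw.2; rewrite /= inE.
  by move=> i; rewrite inE.
elim: k => [|k IH] A C.
  move=> /cards0_eq -> _; rewrite expr0 mulr1 -HE; congr (P _).
  by apply/seteqP; split=> [w []//|w Hw]; split=> // i /=; rewrite inE.
move=> Ck; have [c cC] : exists c, c \in C by apply/card_gt0P; rewrite Ck.
rewrite -(finset.setD1K cC); set C' := (C :\ c)%SET => dAC.
have C'k : #|C'| = k by have := cardsD1 c C; rewrite cC Ck => -[].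
have cA : c \notin A by apply/negP => /dAC; rewrite !inE eqxx.
have dAC' i : i \in A -> i \notin C'.
  by move=> /dAC; apply: contra => iC'; rewrite inE iC' orbT.
have -> : X A (c |: C')%SET = X A C' `\` E c.
  apply/seteqP; split=> w.
    move=> [wA wC]; split; last by apply: wC => /=; rewrite !inE eqxx.
    by split=> // i /= iC'; apply: wC => /=; rewrite inE iC' orbT.
  move=> [[wA wC] wc]; split=> // i /=.
  by rewrite in_setU1 => /orP[/eqP -> //|]; exact: wC.
rewrite measureD//; last by rewrite ltey_eq fin_num_measure.
have -> : X A C' `&` E c = X (c |: A)%SET C'.
  apply/seteqP; split=> w.
    move=> [[wA wC] wc]; split=> // i /=.
    by rewrite in_setU1 => /orP[/eqP -> //|]; exact: wA.
  move=> [wA wC]; split; last by apply: wA => /=; rewrite !inE eqxx.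
  by split=> // i /= iA; apply: wA => /=; rewrite inE iA orbT.
have dcAC' i : i \in (c |: A)%SET -> i \notin C'.
  by rewrite in_setU1 => /orP[/eqP ->|/dAC'//]; rewrite !inE eqxx.
have /= -> := IH A C' C'k dAC'.
have /= -> := IH (c |: A)%SET C' C'k dcAC'.
by rewrite -EFinB cardsU1 cA add1n !exprS; congr (_%:E); ring.
Qed.

Lemma prob_bigsetU_le (J : eqType) (s : seq J) (E : J -> set Omega)
    (b : J -> R) : (forall j, measurable (E j)) ->
  (forall j, j \in s -> (P (E j) <= (b j)%:E)%E) ->
  (P (\big[setU/set0]_(j <- s) E j) <= (\sum_(j <- s) b j)%:E)%E.
Proof.
move=> mE; elim: s => [_|j s IH HE]; first by rewrite !big_nil measure0.
rewrite !big_cons EFinD.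
apply: le_trans (leeD (HE j (mem_head j s)) (IH _)) => [|i si]; last first.
  by apply: HE; rewrite in_cons si orbT.
by apply: measureU2 => //; exact: bigsetU_measurable.
Qed.

(** An open condition on finitely many reals is a countable union of cubes with rational centres and
    radii 1/(j+1). *)
Lemma measurable_box_open (I : finType) (Z : I -> {RV P >-> R})
    (G : (I -> R) -> Prop) :
  (forall z, G z -> exists2 delta : R, 0 < delta &
    forall z', (forall k, `|z k - z' k| < delta) -> G z') ->
  measurable [set w | G (fun k => Z k w)].
Proof.
move=> oG.
pose rad (j : nat) : R := j.+1%:R^-1.
have rad0 j : 0 < rad j by rewrite invr_gt0 ltr0n.
pose box (c : {ffun I -> rat} * nat) (z : I -> R) :=
  forall k, `|ratr (c.1 k) - z k| < rad c.2.
have -> : [set w | G (fun k => Z k w)] =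
  \bigcup_(c in [set c | forall z, box c z -> G z])
    \bigcap_(k in [set: I]) (Z k @^-1` ball (ratr (c.1 k) : R) (rad c.2)).
  apply/seteqP; split=> w /=; last first.
    by move=> [c Gc wc]; apply: Gc => k; exact: wc.
  move=> /oG[delta delta0 Hd].
  have [j jd] : exists j, rad j < delta / 2.
    have d2 : 0 < delta / 2 by lra.
    exists (Num.bound (delta / 2)^-1); rewrite /rad -[ltRHS]invrK ltf_pV2 ?posrE ?invr_gt0//.
    apply: lt_trans (_ : (Num.bound (delta / 2)^-1)%:R < _); last by rewrite ltr_nat.
    by rewrite archi_boundP// invr_ge0 ltW.
  have rat_approx (v : R) : exists q : rat, `|ratr q - v| < rad j.
    have [|q] := @rat_in_itvoo R (v - rad j) (v + rad j).
      by have := rad0 j; lra.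
    by rewrite in_itv/= => /andP[q1 q2]; exists q; rewrite ltr_norml; apply/andP; split; lra.
  have /choice[q Hq] k := rat_approx (Z k w).
  exists ([ffun k => q k], j); last by move=> k _; rewrite /= ffunE; exact: Hq.
  move=> z bz; apply: Hd => k; have := bz k; rewrite ffunE /=; have := Hq k.
  move: (Z k w : R) (ratr (q k) : R) (z k) => a b c H1 H2.
  have := ler_normD (a - b) (b - c).
  by rewrite addrA subrK [`|a - b|]distrC; lra.
rewrite bigcup_mkcond; apply: countable_bigcupT_measurable => // c.
case: ifP => // _; apply: fin_bigcap_measurable => // k _.
by apply: measurable_funPTI; exact: measurable_ball.
Qed.

End Probability.

(** * Estimates for the common law of the weights *)

Section LawEstimates.
Variables (R : realType) (mu : probability (measurableTypeR R) R).

(** Compact sets avoiding 0 that increase to the nonzero reals. *)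
Definition annulus (k : nat) : set R :=
  `[- k.+1%:R, - k.+1%:R^-1] `|` `[k.+1%:R^-1, k.+1%:R].

Lemma annulusP k (t : R) : annulus k t <-> k.+1%:R^-1 <= `|t| <= k.+1%:R.
Proof.
have k0 : (0 : R) < k.+1%:R^-1 by rewrite invr_gt0 ltr0n.
rewrite /annulus; set a := k.+1%:R^-1 in k0 *; set b := k.+1%:R.
split=> [[]/=|].
- rewrite in_itv/= => /andP[H1 H2]; rewrite ler0_norm; last lra.
  by apply/andP; split; lra.
- rewrite in_itv/= => /andP[H1 H2]; rewrite ger0_norm; last lra.
  by apply/andP.
have [t0|t0] := leP 0 t.
  by rewrite ger0_norm// => H; right; rewrite /= in_itv.
rewrite ltr0_norm// => /andP[H1 H2]; left; rewrite /= in_itv/=.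
by apply/andP; split; lra.
Qed.

Lemma annulus_compact k : compact (annulus k).
Proof. by apply: compactU; exact: segment_compact. Qed.

Lemma measurable_annulus k : measurable (annulus k).
Proof. by apply: measurableU; exact: measurable_itv. Qed.

(** The complements decrease to {0}, a null set by absolute continuity; conclude by continuity from
    above. *)
Lemma annulus_exhausts (eta : R) : mu `<< lebesgue_measure -> 0 < eta ->
  exists k, (mu (~` annulus k) < eta%:E)%E.
Proof.
move=> ac eta0.
have capE : \bigcap_k ~` annulus k = [set (0 : R)].
  apply/seteqP; split=> t /=; last first.
    move=> -> k _ /annulusP; rewrite normr0 => /andP[].
    by rewrite leNgt invr_gt0 ltr0n.
  move=> H; apply: contrapT => /eqP t0; have nt : 0 < `|t| by rewrite normr_gt0.
  pose k := (Num.bound `|t| + Num.bound (`|t|^-1))%N.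
  have k1 : `|t| <= k.+1%:R.
    rewrite ltW// (lt_le_trans (archi_boundP _))// ler_nat /k; lia.
  have k2 : `|t|^-1 <= k.+1%:R.
    rewrite ltW// (lt_le_trans (archi_boundP _)) ?invr_ge0// ler_nat /k; lia.
  apply: (H k I); apply/annulusP; rewrite k1 andbT.
  by rewrite -[leRHS]invrK lef_pV2 ?posrE ?invr_gt0// ltr0n.
have mC k : measurable (~` annulus k) by apply: measurableC; exact: measurable_annulus.
have nincr : nonincreasing_seq (fun k => ~` annulus k).
  move=> i j ij; apply/subsetPset => t nj /annulusP/andP[H1 H2].
  apply: nj; apply/annulusP; apply/andP; split.
    by apply: le_trans H1; rewrite lef_pV2 ?posrE ?ltr0n// ler_nat ltnS.
  by apply: le_trans H2 _; rewrite ler_nat ltnS.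
have mu0 : mu (\bigcap_k ~` annulus k) = 0%E.
  rewrite capE; move/null_content_dominatesP : ac; apply; first exact: measurable_set1.
  exact: lebesgue_measure_set1.
have cvg0 : (mu \o (fun k => ~` annulus k)) k @[k --> \oo] --> 0%E.
  rewrite -mu0; apply: nonincreasing_cvg_mu => //.
  - by rewrite (le_lt_trans (probability_le1 mu (mC _)))// ltry.
  - by rewrite capE; exact: measurable_set1.
have [_ /cvgrPdist_lt/(_ _ eta0)[k _ /(_ k (leqnn _))]] :=
  (fine_cvgP _ _).1 cvg0.
rewrite /= sub0r normrN => Hk; exists k.
rewrite -(fineK (fin_num_measure mu _ (mC k))) lte_fin.
by apply: le_lt_trans Hk; exact: ler_norm.
Qed.

Lemma full_support_ball (x r : R) : full_support mu -> 0 < r ->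
  exists2 p : R, 0 < p <= 1 & mu (ball x r) = p%:E.
Proof.
move=> fs r0.
have mb : measurable (ball x r) by exact: measurable_ball.
have pfin : mu (ball x r) \is a fin_num by exact: fin_num_measure.
exists (fine (mu (ball x r))); last by rewrite fineK.
apply/andP; split; last by rewrite -lee_fin fineK// probability_le1.
rewrite -lte_fin fineK//; apply: fs; first exact: ball_open.
by exists x; exact: ballxx.
Qed.

End LawEstimates.

(** * Probability that no neuron comes close to a target *)

Section NeuronHits.
Variables (R : realType) (n d M : nat).
Variables (disp : measure_display) (Omega : measurableType disp).
Variables (P : probability Omega R) (mu : probability (measurableTypeR R) R).
Variable Z : scheme1_index n d M -> {RV P >-> R}.
Hypothesis Z_iid : iid_with_law Z mu.

Definition neuron_hit (t : {ffun neuron_index n d -> R} * R) (i : 'I_M) :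
    set Omega :=
  \bigcap_(k in [set: neuron_index n d])
    (Z (neuron_to_scheme i k) @^-1` ball (t.1 k) t.2).

Lemma measurable_neuron_hit t i : measurable (neuron_hit t i).
Proof.
apply: fin_bigcap_measurable => // k _.
by apply: measurable_funPTI; exact: measurable_ball.
Qed.

(** Distinct neurons use disjoint sets of weights, so their hits are independent, each with the
    product of the ball masses as probability. *)
Lemma prob_no_neuron_hit t :
  P (\bigcap_i ~` neuron_hit t i) =
  ((1 - \prod_k fine (mu (ball (t.1 k) t.2))) ^+ M)%:E.
Proof.
have [Z_law Z_indep] := Z_iid.
rewrite -[in RHS](card_ord M); apply: prob_bigcap_setC => [i|A].
  exact: measurable_neuron_hit.
pose B (s : scheme1_index n d M) : set R := match s with
  | inl (inl (i, j)) => ball (t.1 (Some j)) t.2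
  | inr (inl i) => ball (t.1 None) t.2
  | _ => setT
  end.
have BE i k : B (neuron_to_scheme i k) = ball (t.1 k) t.2 by case: k.
have mB s : measurable (B s).
  by case: s => [[[i j]|ij]|[i|i]] //=; exact: measurable_ball.
pose h (x : 'I_M * neuron_index n d) := neuron_to_scheme x.1 x.2.
have h_inj : injective h.
  move=> [i [j|]] [i' [j'|]] //; rewrite /h/=; first by case=> -> ->.
  by case=> ->.
(* All weights of the neurons in [A]: independence over [J] gives the product formula for the joint
   hits. *)
pose J := [set h x | x in [pred x : 'I_M * neuron_index n d | x.1 \in A]]%SET.
have := Z_indep J B mB.
rewrite (_ : \bigcap_(s in [set` J]) _ = \bigcap_(i in [set` A]) neuron_hit t i).
  move=> ->; rewrite big_imset/=; last by move=> x y _ _; exact: h_inj.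
  under eq_bigr => x _.
    rewrite -[P _]/(distribution P (Z (h x)) (B (h x))) Z_law// /h BE.
    rewrite -[mu _]fineK ?fin_num_measure//; last exact: measurable_ball.
    over.
  rewrite prodEFin; congr (_%:E).
  under eq_bigl => x do rewrite inE -[x.1 \in A]andbT.
  rewrite -(pair_big_dep _ (fun _ _ => true)
    (fun _ k => fine (mu (ball (t.1 k) t.2))))/=.
  by rewrite prodr_const.
apply/seteqP; split=> w /= H.
  move=> i /= iA k _; have /= := H (h (i, k)).
  by rewrite BE; apply; apply/imsetP; exists (i, k).
move=> s /imsetP[[i k] /= iA ->]; rewrite /h BE.
exact: (H i iA k).
Qed.

End NeuronHits.

(** * Choice of M and the union bound *)

Lemma sum_geometric_small (R : realType) (T : eqType) (s : seq T) (q : T -> R)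
    (eta : R) : (forall t, t \in s -> 0 <= q t < 1) -> 0 < eta ->
  exists2 M, (0 < M)%N & \sum_(t <- s) q t ^+ M < eta.
Proof.
move=> q01 eta0.
suff [M0 H] : exists M0, forall M, (M0 <= M)%N -> \sum_(t <- s) q t ^+ M < eta.
  by exists M0.+1 => //; exact: H.
elim: s eta eta0 q01 => [|t s IH] eta eta0 q01.
  by exists 0%N => M _; rewrite big_nil.
have eta20 : 0 < eta / 2 by lra.
have [|M0 H] := IH _ eta20; first by move=> u us; rewrite q01// in_cons us orbT.
have /andP[q0 q1] := q01 t (mem_head t s).
have /cvg_expr/cvgrPdist_lt/(_ _ eta20)[M1 _ H1] : `|q t| < 1.
  by rewrite ger0_norm.
exists (maxn M0 M1) => M; rewrite geq_max => /andP[M0M M1M].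
have := H1 M M1M; rewrite /= sub0r normrN => h1.
have := ler_norm (q t ^+ M); have := H M M0M.
by rewrite big_cons; lra.
Qed.

Theorem proposition9 (R : realType) (n d : nat) (d_gt0 : (0 < d)%N)
    (K : set 'cV[R]_d) (K_compact : compact K)
    (f : {ptws 'I_n -> 'cV[R]_d} -> R)
    (f_continuous : {within Kpow K n, continuous f})
    (sigma : R -> R) (sigma_continuous : continuous sigma)
    (sigma_bounded : bounded_fun sigma)
    (sigma_nonpolynomial : ~ polynomial_fun sigma)
    (sigma_injective : injective sigma) (sigma0 : sigma 0 = 0)
    (mu1 : probability (measurableTypeR R) R)
    (mu1_abs_continuous : mu1 `<< lebesgue_measure)
    (mu1_full_support : full_support mu1)
    (alpha : R) (alpha_gt0 : 0 < alpha) (alpha_lt1 : alpha < 1)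
    (eps : R) (eps_gt0 : 0 < eps) :
  exists2 M : nat, (0 < M)%N &
    forall (disp : measure_display) (Omega : measurableType disp)
      (P : probability Omega R) (Z : scheme1_index n d M -> {RV P >-> R}),
    iid_with_law Z mu1 ->
    let good := [set omega : Omega |
      exists w' : 'cV[R]_M,
        let w := col_mx w' 0 : 'cV[R]_(M + n.+1 * d) in
        forall xT : 'cV[R]_d,
          (ereal_sup [set (`| f x - inner w (scheme1_DeltaRS
                                 (fun k => Z k omega) sigma
                                 (extend_stream x xT) n.+1) |)%:E
                     | x in Kpow K n]
           < eps%:E)%E] in
    measurable good /\ (alpha%:E < P good)%E.
Proof.
have sb : exists B : R, forall t, `|sigma t| <= B.
  have [B [_ HB]] := sigma_bounded; exists (B + 1) => t.
  by apply: (HB (B + 1)) => //; rewrite ltrDl.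
(* The allowed failure probability is shared equally by two bad events: a weight in U or alpha
   leaving the annulus, and a target missed by all neurons. *)
pose eta := (1 - alpha) / 2.
have eta0 : 0 < eta by rewrite /eta; lra.
pose N := #|dyn_index n d|.
have N0 : (0 : R) < N.+1%:R by rewrite ltr0n.
(* With N + 1 in the denominator, the sum over the N weights stays strictly below [eta]. *)
have [k Hk] := annulus_exhausts mu1_abs_continuous (divr_gt0 eta0 N0).
have nD0 : ~ annulus k (0 : R).
  by move=> /annulusP; rewrite normr0 leNgt invr_gt0 ltr0n.
have [tg tg0 Htg] := finite_targets d_gt0 K_compact f_continuous
  sigma_continuous sb sigma_injective sigma0 eps_gt0 (@annulus_compact R k) nD0.
pose q (t : {ffun neuron_index n d -> R} * R) : R :=
  1 - \prod_j fine (mu1 (ball (t.1 j) t.2)).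
have q01 t : t \in tg -> 0 <= q t < 1.
  move=> /tg0 t0; rewrite /q subr_ge0 ltrBlDr ltrDl.
  have p01 j : 0 < fine (mu1 (ball (t.1 j) t.2)) <= 1.
    by have [p p01 ->] := full_support_ball (t.1 j) mu1_full_support t0.
  apply/andP; split; last by apply: prodr_gt0 => j _; case/andP: (p01 j).
  by apply: prodr_ile1 => j _; case/andP: (p01 j) => /ltW -> ->.
(* Targets and miss rates depend only on the law, so M is fixed before the probability space. *)
have [M M0 HM] := sum_geometric_small q01 eta0.
exists M => // disp Omega P Z iidZ good.
have goodE : good =
    [set w | approximates K f sigma eps (fun s => Z s w)].
  by apply/seteqP; split=> w; rewrite /= (approximates_sup K f sigma0).
have mgood : measurable good.
  rewrite goodE; apply: measurable_box_open => z.
  exact: approximates_open.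
split => //.
pose out (j : dyn_index n d) : set Omega :=
  Z (dyn_to_scheme M j) @^-1` (~` annulus k).
pose miss (t : {ffun neuron_index n d -> R} * R) : set Omega :=
  \bigcap_i ~` neuron_hit Z t i.
have mout j : measurable (out j).
  by apply: measurable_funPTI; apply: measurableC; exact: measurable_annulus.
have mmiss t : measurable (miss t).
  apply: fin_bigcap_measurable => // i _; apply: measurableC.
  exact: measurable_neuron_hit.
pose Out := \big[setU/set0]_(j <- enum (dyn_index n d)) out j.
pose Miss := \big[setU/set0]_(t <- tg) miss t.
have mOut : measurable Out by exact: bigsetU_measurable.
have mMiss : measurable Miss by exact: bigsetU_measurable.
(* Off both bad events the weights in U and alpha lie in the annulus and every target is hit. *)
have subgood : ~` (Out `|` Miss) `<=` good.
  rewrite setCU goodE => w [nO nM] /=; apply: Htg.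
    move=> j; apply: contrapT => nj; apply: nO.
    rewrite /Out -bigcup_seq; exists j => //=.
    by rewrite mem_enum.
  move=> t ttg; apply: contrapT => nhit; apply: nM.
  rewrite /Miss -bigcup_seq; exists t => // i _ hit.
  by apply: nhit; exists i => j; exact: (hit j I).
have POut : (P Out <= (\sum_(j <- enum (dyn_index n d)) eta / N.+1%:R)%:E)%E.
  apply: prob_bigsetU_le => // j _.
  rewrite -[P _]/(distribution P (Z (dyn_to_scheme M j)) (~` annulus k)).
  rewrite (iidZ.1); last by apply: measurableC; exact: measurable_annulus.
  exact: ltW.
have PMiss : (P Miss <= (\sum_(t <- tg) q t ^+ M)%:E)%E.
  by apply: prob_bigsetU_le => // t _; rewrite (prob_no_neuron_hit iidZ).
have PU : (P (Out `|` Miss) < (1 - alpha)%:E)%E.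
  apply: le_lt_trans (measureU2 _ mOut mMiss) _.
  apply: le_lt_trans (leeD POut PMiss) _; rewrite -EFinD lte_fin.
  rewrite big_const_seq count_predT -cardE iter_addr addr0 -/N.
  have NE : eta / N.+1%:R *+ N < eta.
    by rewrite -mulr_natr mulrAC ltr_pdivrMr// ltr_pM2l// ltr_nat.
  have etaD : eta + eta = 1 - alpha by rewrite /eta; lra.
  by rewrite -etaD ltrD.
have mU : measurable (Out `|` Miss) by exact: measurableU.
apply: lt_le_trans (_ : (P (~` (Out `|` Miss)) <= _)%E); last first.
  by apply: le_measure => //; rewrite inE//; exact: measurableC.
rewrite probability_setC//.
move: PU; rewrite -(fineK (fin_num_measure P _ mU)) -EFinB !lte_fin; lra.
Qed.
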